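(* Let $n>2$ and $G=\mathrm{GL}_{n^2}(\mathbb{C})$. Then the saturation $\mathrm{Sat}(S(\mathrm{Det}_n))$ contains every partition $\lambda$ (viewed as an element of $\mathbb{Z}^{n^2}$ by padding with zeros) with $\ell(\lambda)\le n$ and $|\lambda|\equiv 0 \bmod n$. In particular, every such $\lambda$ that does not lie in $S(\mathrm{Det}_n)$ is a hole of $S(\mathrm{Det}_n)$, i.e. lies in $\mathrm{Sat}(S(\mathrm{Det}_n))\setminus S(\mathrm{Det}_n)$.
   Context: $G=\mathrm{GL}_{n^2}(\mathbb{C})$ acts on the space $\mathrm{Pol}_n(\mathbb{C}^{n^2})$ of homogeneous forms of degree $n$ in $n^2$ variables $X_{ij}$ by linear substitution, $(gw)(x)=w(g^Tx)$. $\mathrm{Det}_n$ is the closure (Zariski, equivalently Euclidean) of the $G$-orbit of the determinant $\det_n$ of the $n\times n$ matrix $(X_{ij})$. Highest weights of $G$ are weakly decreasing vectors $\lambda\in\mathbb{Z}^{n^2}$; $V_G(\lambda)$ denotes the irreducible rational $G$-module of highest weight $\lambda$; the polynomial ones correspond to partitions (nonnegative entries), with $|\lambda|=\sum_i\lambda_i$ and $\ell(\lambda)$ the number of nonzero parts. $G$ acts on the coordinate ring $\mathcal{O}(Z)$ of a $G$-invariant closed subvariety $Z$ by $(gF)(z)=F(g^{-1}z)$, and $S(Z)$ is the set of highest weights $\lambda$ such that the dual $V_G(\lambda)^*$ occurs (as a submodule) in $\mathcal{O}(Z)$; it is a submonoid of $\mathbb{Z}^{n^2}$. For a submonoid $S$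 of a free abelian group $F$, with $A(S)=S-S$ the group generated by $S$, $S$ is saturated if for all $x\in A(S)$ and $k\in\mathbb{N}_{>0}$, $kx\in S$ implies $x\in S$; the saturation $\mathrm{Sat}(S)$ is the smallest saturated submonoid of $F$ containing $S$ (equivalently $A(S)$ intersected with the rational cone generated by $S$). Elements of $\mathrm{Sat}(S)\setminus S$ are called holes. *)

(* Defs.v *)
From HB Require Import structures.
From mathcomp Require Import all_boot all_order all_algebra.
From mathcomp Require Import perm classical_sets reals.
From mathcomp Require Import complex.
From mathcomp Require Import mpoly.

Set Implicit Arguments.
Unset Strict Implicit.
Unset Printing Implicit Defensive.

Import Order.TTheory GRing.Theory Num.Theory.

Local Open Scope classical_set_scope.
Local Open Scope ring_scope.
Local Open Scope complex_scope.

Section Saturation.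
Variable F : zmodType.
Implicit Types S T : set F.

Definition submonoid S : Prop :=
  S 0 /\ forall x y, S x -> S y -> S (x + y).

(* A(S) = S - S, which is a group as soon as S is a submonoid. *)
Definition diff_group S : set F :=
  [set x | exists a b, [/\ S a, S b & x = a - b]].

Definition saturated S : Prop :=
  forall x (k : nat), diff_group S x -> (0 < k)%N -> S (x *+ k) -> S x.

Definition Sat S : set F :=
  smallest [set T | submonoid T /\ saturated T] S.

Definition hole S : set F := [set x | Sat S x /\ ~ S x].

End Saturation.

Section PolynomialFunctions.
Variables (R : realType) (V : lmodType R[i]).

(* The algebra generated by the linear forms on V; for finite-dimensional V
   this is the coordinate ring of the affine space V. *)
Definition polyfun (f : V -> R[i]) : Prop :=
  exists (m : nat) (l : 'I_m -> {scalar V}) (p : {mpoly R[i][m]}),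
    forall v, f v = p.@[fun i => l i v].

Definition zariski_closed (Z : set V) : Prop :=
  exists2 E : set (V -> R[i]), E `<=` polyfun &
    Z = [set v | forall f, E f -> f v = 0].

Definition zariski_closure (A : set V) : set V := smallest zariski_closed A.

End PolynomialFunctions.

(* GL_N(C) is the set of g : 'M[R[i]]_N such that g \in unitmx; the values of
   a representation at singular matrices are irrelevant. *)
Section Representations.
Variables (R : realType) (N : nat).
Local Notation C := R[i].

(* Restrictions to GL_N of elements of C[g_ij, 1/det]. *)
Definition regular_on_GL (f : 'M[C]_N -> C) : Prop :=
  exists (p : 'M[C]_N -> C) (k : nat), polyfun p /\
    forall g, g \in unitmx -> f g = p g / \det g ^+ k.

Section Module.
Variables (W : vectType C) (rho : 'M[C]_N -> 'End(W)).

Definition rational_module : Prop :=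
  [/\ rho 1%:M = \1%VF,
      forall g h, g \in unitmx -> h \in unitmx ->
        rho (g *m h) = (rho g \o rho h)%VF
    & forall (l : 'Hom(W, C^o)) (v : W), regular_on_GL (fun g => l (rho g v))].

Definition irreducible_module : Prop :=
  {:W}%VS != 0%VS /\
  forall U : {vspace W},
    (forall g, g \in unitmx -> (rho g @: U <= U)%VS) ->
    U = 0%VS \/ U = {:W}%VS.

Definition upper_unitriangular (g : 'M[C]_N) : Prop :=
  forall i j : 'I_N, (j <= i)%N -> g i j = (i == j)%:R.

Definition highest_weight_vector (lambda : 'rV[int]_N) (v : W) : Prop :=
  [/\ v != 0,
      forall g, upper_unitriangular g -> rho g v = v
    & forall t : 'rV[C]_N, (forall i, t 0 i != 0) ->
        rho (diag_mx t) v = (\prod_i t 0 i ^ lambda 0 i) *: v].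

(* (W, rho) is (a model of) V_G(lambda). *)
Definition irreducible_of_highest_weight (lambda : 'rV[int]_N) : Prop :=
  [/\ rational_module, irreducible_module
    & exists v, highest_weight_vector lambda v].

Definition dual_act (g : 'M[C]_N) (phi : 'Hom(W, C^o)) : 'Hom(W, C^o) :=
  (phi \o rho (invmx g))%VF.

End Module.

Definition dominant (lambda : 'rV[int]_N) : Prop :=
  forall i j : 'I_N, (i <= j)%N -> lambda 0 j <= lambda 0 i.

Definition partition_weight (lambda : 'rV[int]_N) : Prop :=
  dominant lambda /\ forall i, 0 <= lambda 0 i.

Definition weight_size (lambda : 'rV[int]_N) : int := \sum_i lambda 0 i.

Definition weight_length (lambda : 'rV[int]_N) : nat :=
  #|[set i | lambda 0 i != 0]%SET|.

End Representations.

Section Forms.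
Variables (R : realType) (N d : nat).
Local Notation C := R[i].

(* Pol_d(C^N) is the library type [dhomog N C d]. *)
Local Notation Pol := (dhomog N C d).

(* x_j |-> (g^T x)_j *)
Definition subst_forms (g : 'M[C]_N) : N.-tuple {mpoly C[N]} :=
  [tuple \sum_(k < N) g^T j k *: 'X_k | j < N].

Lemma form_act_subproof (g : 'M[C]_N) (w : Pol) :
  (w : {mpoly C[N]}) \mPo subst_forms g \is d.-homog.
Proof.
rewrite comp_mpolyE big_seq; apply: rpred_sum => m hm; apply: rpredZ.
have /dhomogP/(_ m hm) <- := dhomog_is_dhomog w.
rewrite /= mdegE; elim/big_ind2: _ => [|p1 e1 p2 e2 h1 h2|i _].
- exact: dhomog1.
- exact: dhomogM.
have hom1 : tnth (subst_forms g) i \is 1.-homog.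
  by rewrite tnth_mktuple; apply: rpred_sum => k _; apply: rpredZ; rewrite dhomogX /= mdeg1.
by have := dhomogMn (m i) hom1; rewrite mul1n.
Qed.

Definition form_act (g : 'M[C]_N) (w : Pol) : Pol :=
  DHomog (form_act_subproof g w).

Lemma form_actE (g : 'M[C]_N) (w : Pol) (x : 'cV[C]_N) :
  (form_act g w : {mpoly C[N]}).@[fun i => x i 0]
  = (w : {mpoly C[N]}).@[fun i => (g^T *m x) i 0].
Proof.
rewrite comp_mpoly_meval; apply: meval_eq => i.
rewrite tnth_mktuple mxE raddf_sum; apply: eq_bigr => k _.
by rewrite /= mevalZ mevalXU.
Qed.

Definition form_orbit (w : Pol) : set Pol :=
  [set w' | exists2 g, g \in unitmx & w' = form_act g w].

(* W^* occurs in O(Z): there is an injective G-linear map Phi : W^* -> O(Z).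
   An element of O(Z) is given by a polynomial function on the ambient space,
   two of them being identified when they agree on Z.  The action of G on O(Z)
   is (g F)(z) = F(g^-1 z). *)
Definition dual_occurs (W : vectType C) (rho : 'M[C]_N -> 'End(W))
    (Z : set Pol) : Prop :=
  exists Phi : 'Hom(W, C^o) -> Pol -> C,
    [/\ forall phi, polyfun (Phi phi),
        forall a phi psi z, Z z ->
          Phi (a *: phi + psi) z = a * Phi phi z + Phi psi z,
        forall g phi z, g \in unitmx -> Z z ->
          Phi (dual_act rho g phi) z = Phi phi (form_act (invmx g) z)
      & forall phi, (forall z, Z z -> Phi phi z = 0) -> phi = 0].

(* S(Z), for Z closed and G-invariant. *)
Definition highest_weights (Z : set Pol) : set 'rV[int]_N :=
  [set lambda | dominant lambda /\
     exists (W : vectType C) (rho : 'M[C]_N -> 'End(W)),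
       irreducible_of_highest_weight rho lambda /\ dual_occurs rho Z].

End Forms.

Section Determinant.
Variables (R : realType) (n : nat).
Local Notation C := R[i].

(* X_ij is the variable of index [mxvec_index i j]. *)
Definition generic_matrix : 'M[{mpoly C[n * n]}]_n :=
  \matrix_(i, j) 'X_(mxvec_index i j).

Lemma det_form_subproof : \det generic_matrix \is n.-homog.
Proof.
rewrite /determinant; apply: rpred_sum => s _; rewrite -signr_odd.
have H : \prod_i generic_matrix i (s i) \is n.-homog.
  rewrite -[X in X.-homog]card_ord -sum1_card.
  elim/big_ind2: _ => [|p1 e1 p2 e2 h1 h2|i _].
  - exact: dhomog1.
  - exact: dhomogM.
  by rewrite mxE dhomogX /= mdeg1.
by case: (odd _); rewrite ?expr1 ?expr0 ?mulN1r ?mul1r ?rpredN.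
Qed.

Definition det_form : dhomog (n * n) C n := DHomog det_form_subproof.

Definition Det : set (dhomog (n * n) C n) := zariski_closure (form_orbit det_form).

End Determinant.

Arguments Det R n : clear implicits.

(* Main.v *)
Require Import Defs.
From HB Require Import structures.
From mathcomp Require Import all_boot all_order all_algebra.
From mathcomp Require Import classical_sets reals.
From mathcomp Require Import perm boolp complex mpoly zify ring.

(* A weight lambda lies in S(Det_n) as soon as some highest weight vector v of
   weight lambda in a tensor power of C^(n^2) satisfies <w^(x)d, v> <> 0 for a
   form w = g det_n, where g may be singular: the module W generated by v is
   irreducible, and w |-> w^(x)d followed by the orthogonal projection onto W
   is an equivariant polynomial map that does not vanish on the orbit.

   Some multiple of each (1^j), j <= n, lies in S(Det_n).  Products of n linear
   forms in j variables have the shape g det_n.  The ring of multihomogeneous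
   polynomials in the n linear forms is finite over the ring generated by the
   coefficients of their product, because b_a b_a' = b_min(a,a') b_max(a,a')
   for the monomials b_a = prod_i l_(i, a_i) makes every b_a nilpotent modulo
   these coefficients.  Hence the product Q of the cyclic j x j minors of the
   matrix of the l_i satisfies an integral equation over the smaller ring, and
   projecting this equation to the GL_j-semi-invariants shows that one of its
   coefficients has a nonzero semi-invariant part.

   The differences of S(Det_n) contain all integer vectors supported on the
   first n coordinates whose size is divisible by n.  This follows from explicit
   highest weight vectors, evaluated at the Hessenberg determinants
   sum_b x_0^(n-1-mu_b) x_1^(mu_b) x_b.

   A partition lambda as in the theorem thus has a multiple in the monoid
   generated by S(Det_n), and lies in the group generated by S(Det_n). *)

Set Implicit Arguments.
Unset Strict Implicit.
Unset Printing Implicit Defensive.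

Import Order.TTheory GRing.Theory Num.Theory.

Local Open Scope ring_scope.

(** * Orthogonal projections *)

Section SpanOfPredicate.
Variables (K : fieldType) (V : vectType K).

(** A list of vectors satisfying [P] is enlarged by one outside its span as long as possible; the
    codimension drops each time, so this stops. It provides finite spanning families for infinite
    sets such as orbits. *)
Lemma span_predicate (P : V -> Prop) :
  exists2 s : seq V, (forall x, x \in s -> P x) & (forall x, P x -> x \in <<s>>%VS).
Proof.
suff H k (s : seq V) : (\dim {:V} - \dim <<s>> < k)%N -> (forall x, x \in s -> P x) ->
    exists2 s : seq V, (forall x, x \in s -> P x) & (forall x, P x -> x \in <<s>>%VS).
  by apply: (H (\dim {:V} - \dim <<[::] : seq V>>).+1 [::]).
elim: k s => // k IH s hk hs.
have [h|] := pselect (forall x, P x -> x \in <<s>>%VS); first by exists s.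
move=> /existsNP [x] /not_implyP [Px /negP nx].
apply: (IH (x :: s)); last first.
  by move=> y; rewrite inE => /predU1P [->|/hs].
have lt : (\dim <<s>> < \dim <<x :: s>>)%N.
  rewrite ltn_neqAle; apply/andP; split; last first.
    by apply: dimvS; rewrite span_cons addvSr.
  apply: contra nx => /eqP e.
  have /eqP -> : <<s>>%VS == <<x :: s>>%VS.
    by rewrite eqEdim span_cons addvSr -span_cons e /=.
  by rewrite memv_span // mem_head.
rewrite -ltnS; apply: leq_trans hk.
by rewrite ltnS; apply: ltn_sub2l => //; apply: leq_trans lt (dimvS (subvf _)).
Qed.

End SpanOfPredicate.

Section Hermitian.
Variables (C : numClosedFieldType) (X : finType).
Local Notation V := {ffun X -> C^o}.
Implicit Types (u v w : V) (U : {vspace V}).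

Definition dot u v : C := \sum_x u x * Num.conj (v x).

Lemma dotDl u v w : dot (u + v) w = dot u w + dot v w.
Proof. by rewrite /dot -big_split; apply: eq_bigr => x _; rewrite ffunE mulrDl. Qed.

Lemma dotZl a u w : dot (a *: u) w = a * dot u w.
Proof. by rewrite /dot mulr_sumr; apply: eq_bigr => x _; rewrite ffunE mulrA. Qed.

Lemma dotC u v : dot u v = Num.conj (dot v u).
Proof.
rewrite /dot rmorph_sum; apply: eq_bigr => x _.
by rewrite rmorphM /= conjCK mulrC.
Qed.

Lemma dotDr u v w : dot w (u + v) = dot w u + dot w v.
Proof. by rewrite dotC dotDl rmorphD /= -!dotC. Qed.

Lemma dotZr a u w : dot w (a *: u) = Num.conj a * dot w u.
Proof. by rewrite dotC dotZl rmorphM /= -dotC. Qed.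

Lemma dotNl u w : dot (- u) w = - dot u w.
Proof. by rewrite -scaleN1r dotZl mulN1r. Qed.

Lemma dotBl u v w : dot (u - v) w = dot u w - dot v w.
Proof. by rewrite dotDl dotNl. Qed.

Lemma dotNr u w : dot w (- u) = - dot w u.
Proof. by rewrite dotC dotNl rmorphN /= -dotC. Qed.

Lemma dotBr u v w : dot w (u - v) = dot w u - dot w v.
Proof. by rewrite dotDr dotNr. Qed.

Lemma dot0l w : dot 0 w = 0.
Proof. by rewrite -(scale0r w) dotZl mul0r. Qed.

Lemma dot0r w : dot w 0 = 0.
Proof. by rewrite dotC dot0l conjC0. Qed.

Lemma dot_suml (I : Type) (r : seq I) (P : pred I) (F : I -> V) w :
  dot (\sum_(i <- r | P i) F i) w = \sum_(i <- r | P i) dot (F i) w.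
Proof. by elim/big_rec2: _ => [|i x y _ <-]; rewrite ?dot0l ?dotDl. Qed.

Lemma dot_eq0 v : (dot v v == 0) = (v == 0).
Proof.
apply/idP/eqP => [|->]; last by rewrite dot0l.
rewrite psumr_eq0 => [|x _]; last by rewrite mul_conjC_ge0.
move=> /allP h; apply/ffunP => x; rewrite ffunE.
by have := h x (mem_index_enum x); rewrite /= mul_conjC_eq0 => /eqP.
Qed.

Lemma orth_span (s : seq V) v :
  exists2 a, a \in <<s>>%VS & forall b, b \in <<s>>%VS -> dot (v - a) b = 0.
Proof.
elim: s v => [|x s IH] v.
  exists 0; first exact: mem0v.
  by move=> b; rewrite span_nil memv0 => /eqP ->; rewrite dot0r.
have [t ts ht] := IH v; have [p ps hp] := IH x.
pose q := x - p; have hq b : b \in <<s>>%VS -> dot q b = 0 by apply: hp.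
have qs : q \in <<x :: s>>%VS.
  rewrite span_cons -[q]/(x - p) memv_add ?memv_line ?memvN //.
(* A Gram-Schmidt step. If [q = 0], the quotient is 0 by the convention for division, and [x = p]
   already lies in the span of [s]. *)
exists (t + (dot (v - t) q / dot q q) *: q).
  apply: rpredD; last exact: rpredZ.
  by rewrite span_cons; apply: subvP ts; apply: addvSr.
move=> b; rewrite span_cons => /memv_addP [_ /vlineP [c ->]] [d ds ->].
have -> : c *: x + d = c *: q + (c *: p + d) by rewrite addrA -scalerDr subrK.
have ds' : c *: p + d \in <<s>>%VS by rewrite rpredD // rpredZ.
rewrite dotDr opprD addrA [X in _ + X]dotBl dotZl (hq _ ds') mulr0 subr0 (ht _ ds') addr0.
rewrite dotZr dotBl dotZl.
have [q0|q0] := eqVneq q 0; first by rewrite q0 !dot0r !(mulr0, subr0, mul0r).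
by rewrite divfK ?dot_eq0 // subrr mulr0.
Qed.

Lemma orth_decomposition U v :
  exists2 a, a \in U & forall b, b \in U -> dot (v - a) b = 0.
Proof. by have := orth_span (vbasis U) v; rewrite (span_basis (vbasisP U)). Qed.

Lemma orth_complement U : {Up : {vspace V} | forall v,
  v \in Up <-> forall b, b \in U -> dot v b = 0}.
Proof.
apply: cid.
have [s hs hP] := span_predicate (fun v => forall b, b \in U -> dot v b = 0).
exists <<s>>%VS => v; split; last exact: hP.
move=> vs b bU.
rewrite (coord_span (X := in_tuple s) vs) dot_suml big1 // => i _.
by rewrite dotZl hs ?mulr0 // mem_nth.
Qed.

Lemma orth_sum U (Up : {vspace V}) : (forall v, v \in Up <-> forall b, b \in U -> dot v b = 0) ->
  (U :&: Up = 0)%VS /\ (U + Up = fullv)%VS.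
Proof.
move=> hU; split.
  apply/eqP; rewrite -subv0; apply/subvP => v; rewrite memv_cap => /andP [vU /hU h].
  by rewrite memv0 -dot_eq0; apply/eqP/h.
apply/eqP; rewrite eqEsubv subvf /=; apply/subvP => v _.
have [a aU ha] := orth_decomposition U v.
by rewrite -(subrK a v) addrC memv_add //; apply/hU.
Qed.

Lemma ffun_expand v : v = \sum_x v x *: [ffun y => (y == x)%:R : C^o].
Proof.
apply/ffunP => y; rewrite sum_ffunE (bigD1 y) //= big1 => [|x xy].
  by rewrite addr0 !ffunE eqxx [RHS]mulr1.
by rewrite !ffunE eq_sym (negbTE xy) [LHS]mulr0.
Qed.

Lemma linear_expand (W : lmodType C) (l : {linear V -> W}) v :
  l v = \sum_x v x *: l [ffun y => (y == x)%:R : C^o].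
Proof. by rewrite {1}(ffun_expand v) linear_sum; apply: eq_bigr => x _; rewrite linearZ. Qed.

End Hermitian.

(** * Generic LDU decompositions *)

Section LDU.
Variable C : numFieldType.

Definition lower_unitri N (g : 'M[C]_N) : Prop :=
  forall i j : 'I_N, (i <= j)%N -> g i j = (i == j)%:R.

Definition upper_unitri N (g : 'M[C]_N) : Prop :=
  forall i j : 'I_N, (j <= i)%N -> g i j = (i == j)%:R.

Definition LDU N (A : 'M[C]_N) : Prop :=
  exists L (t : 'rV[C]_N) U, [/\ lower_unitri L, forall i, t 0 i != 0, upper_unitri U
    & A = L *m diag_mx t *m U].

(** One step of Gaussian elimination. The Schur complement is multiplied by the pivot so that its
    entries stay polynomial in those of [A]; the factor is divided out again in the diagonal
    part. *)
Lemma LDU_step N (A : 'M[C]_(1 + N)) : A 0 0 != 0 ->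
  LDU (A 0 0 *: drsubmx A - dlsubmx A *m ursubmx A) -> LDU A.
Proof.
set a := A 0 0; set c := dlsubmx A; set b := ursubmx A; set S := drsubmx A.
move=> a0 [L [t [U [hL ht hU e]]]].
exists (block_mx 1%:M 0 (a^-1 *: c) L), (row_mx a%:M (a^-1 *: t)),
  (block_mx 1%:M (a^-1 *: b) 0 U); split.
- move=> i j; case: (split_ordP i) => i' ->; case: (split_ordP j) => j' -> /= le.
  + by rewrite block_mxEul mxE eq_lshift.
  + by rewrite block_mxEur mxE eq_lrshift.
  + by move: le; rewrite [j']ord1.
  + by rewrite block_mxEdr eq_rshift hL // -(leq_add2l 1).
- move=> i; case: (split_ordP i) => i' ->.
    by rewrite row_mxEl mxE [i']ord1.
  by rewrite row_mxEr mxE mulf_neq0 ?invr_eq0.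
- move=> i j; case: (split_ordP i) => i' ->; case: (split_ordP j) => j' -> /= le.
  + by rewrite block_mxEul mxE eq_lshift.
  + by move: le; rewrite [i']ord1.
  + by rewrite block_mxEdl mxE eq_rlshift.
  + by rewrite block_mxEdr eq_rshift hU // -(leq_add2l 1).
rewrite diag_mx_row -[LHS]submxK.
have -> : diag_mx a%:M = a%:M :> 'M_1.
  by apply/matrixP => i j; rewrite !mxE !ord1.
have -> : diag_mx (a^-1 *: t) = a^-1 *: diag_mx t by rewrite linearZ.
rewrite !mulmx_block !mul0mx !mulmx0 !mul1mx !addr0 !add0r ?mulmx1.
rewrite !(=^~ scalemxAl, =^~ scalemxAr) -e -/S -/b -/c !mul_mx_scalar !mul_scalar_mx !scalerA !mulVf // !scale1r scalerBr scalerA mulVf // scale1r.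
rewrite mul0mx addr0 -scalemxAl scalerA divfK // addrC subrK.
congr block_mx; apply/matrixP => i j.
by rewrite !ord1 !mxE /a !lshift0 mulr1n.
Qed.

(** Dominance of the diagonal in degree passes to the scaled Schur complement, with [e] replaced by
    [e + e]. Hence every pivot is a nonzero polynomial, and [m] is the product of the pivots. *)
Lemma generic_LDU N (e : nat) (M : 'M[{poly C}]_N) :
  (forall i, size (M i i) = e.+1) -> (forall i j, i != j -> (size (M i j) <= e)%N) ->
  exists2 m : {poly C}, m != 0 &
    forall x, m.[x] != 0 -> LDU (map_mx (horner_eval x) M).
Proof.
elim: N e M => [|N IH] e M hd ho.
  exists 1; first exact: oner_neq0.
  move=> x _; exists 1%:M, 0, 1%:M; split; try by case.
  by apply/matrixP; case.
pose M' : 'M[{poly C}]_(1 + N) := M.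
pose S := M' 0 0 *: drsubmx M' - dlsubmx M' *m ursubmx M'.
have SE i j : S i j = M 0 0 * M (rshift 1 i) (rshift 1 j)
    - M (rshift 1 i) 0 * M 0 (rshift 1 j).
  rewrite /S !mxE big_ord1 !mxE /M' !lshift0; do 3!congr (_ - _).
have nz i : (M i i != 0) by rewrite -size_poly_eq0 hd.
have small i j : (size (M (rshift 1 i) 0 * M 0 (rshift 1 j))%R <= e + e)%N.
  have h1 : (size (M (rshift 1 i) 0)%R <= e)%N by apply: ho.
  have h2 : (size (M 0 (rshift 1 j))%R <= e)%N by apply: ho.
  apply: leq_trans (size_polyMleq _ _) _.
  by apply: leq_trans (leq_pred _) _; apply: leq_add.
have [|i j ij|m m0 hm] := IH (e + e)%N S.
- move=> i; rewrite SE size_polyDl.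
    by rewrite size_mul ?nz // (hd (rshift 1 i)) (hd 0) addSn addnS.
  by rewrite size_polyN [X in (_ < X)%N]size_mul ?nz // (hd (rshift 1 i)) (hd 0) addSn addnS ltnS; apply: small.
- rewrite SE; apply: leq_trans (size_polyD _ _) _.
  rewrite geq_max size_polyN small andbT.
  apply: leq_trans (size_polyMleq _ _) _; rewrite hd addSn /=.
  by rewrite leq_add2l ho // eq_rshift.
exists (M 0 0 * m); first by rewrite mulf_neq0.
move=> x; rewrite hornerM mulf_eq0 negb_or => /andP [h0 hx].
apply: LDU_step; first by rewrite mxE /horner_eval.
suff -> : map_mx (horner_eval x) M 0 0 *: drsubmx (map_mx (horner_eval x) M')
    - dlsubmx (map_mx (horner_eval x) M') *m ursubmx (map_mx (horner_eval x) M')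
    = map_mx (horner_eval x) S by apply: hm.
by rewrite map_mxB map_mxZ map_mxM map_dlsubmx map_ursubmx map_drsubmx mxE.
Qed.

Lemma poly_eq0_pointwise (p : {poly C}) : (forall x, p.[x] = 0) -> p = 0.
Proof.
move=> h; apply/eqP; apply: contraT => p0.
have := @max_poly_roots _ p [seq i%:R | i <- iota 0 (size p)] p0.
rewrite size_map size_iota ltnn => ->//.
  by apply/allP => x _; apply/eqP.
rewrite map_inj_uniq ?iota_uniq // => i j /eqP; rewrite eqr_nat; exact/eqP.
Qed.

(** The line [g + x%:M] replaces the Zariski density of the big cell: it passes through [g] at 0,
    and all but finitely many of its points have an LDU decomposition. *)
Lemma generic_LDU_shift N (g : 'M[C]_N) :
  exists2 m : {poly C}, m != 0 & forall x, m.[x] != 0 -> LDU (g + x%:M).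
Proof.
have [||m m0 hm] := @generic_LDU N 1 (map_mx polyC g + 'X%:M).
- by move=> i; rewrite !mxE eqxx mulr1n addrC size_XaddC.
- by move=> i j ij; rewrite !mxE (negbTE ij) mulr0n addr0 size_polyC_leq1.
exists m => // x /hm.
congr LDU; apply/matrixP => i j; rewrite !mxE /horner_eval hornerD hornerC.
by rewrite hornerMn hornerX.
Qed.

End LDU.

(** * Irreducible modules generated by highest weight vectors *)

Definition adjmx (C : numClosedFieldType) m n (g : 'M[C]_(m, n)) : 'M[C]_(n, m) :=
  map_mx Num.conj g^T.

Section Adjoint.
Variables (C : numClosedFieldType) (N : nat).
Implicit Types g : 'M[C]_N.

Lemma adjmxK m n (g : 'M[C]_(m, n)) : adjmx (adjmx g) = g.
Proof. by apply/matrixP => i j; rewrite !mxE conjCK. Qed.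

Lemma det_adjmx g : \det (adjmx g) = Num.conj (\det g).
Proof. by rewrite /adjmx det_map_mx det_tr. Qed.

Lemma adjmx_unit g : (adjmx g \in unitmx) = (g \in unitmx).
Proof. by rewrite !unitmxE det_adjmx !unitfE conjC_eq0. Qed.

Lemma adjmx_lower_unitri g : lower_unitri g -> upper_unitri (adjmx g).
Proof. by move=> h i j ij; rewrite !mxE h // conjC_nat eq_sym. Qed.

End Adjoint.

Section IrreducibleSpan.
Variables (C : numClosedFieldType) (X : finType) (N : nat).
Local Notation V := {ffun X -> C^o}.
Variable r : 'M[C]_N -> 'End(V).
Hypothesis r1 : r 1%:M = \1%VF.
Hypothesis rM : forall g h, r (g *m h) = (r g \o r h)%VF.
Hypothesis radj : forall g u v, dot (r g u) v = dot u (r (adjmx g) v).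
Hypothesis rline : forall g u v, exists p : {poly C}, forall x, dot (r (g + x%:M) u) v = p.[x].
Implicit Types (u v w : V) (U W : {vspace V}).

Lemma rMv g h u : r (g *m h) u = r g (r h u).
Proof. by rewrite rM lfunE. Qed.

Lemma det_shift_poly (g : 'M[C]_N) : exists2 m : {poly C}, m != 0 & forall x, m.[x] != 0 -> g + x%:M \in unitmx.
Proof.
exists (char_poly (- g)); first by rewrite monic_neq0 ?char_poly_monic.
move=> x hx; rewrite unitmxE unitfE; apply: contra hx => /eqP h.
rewrite -[_.[x]]/(horner_eval x _) -det_map_mx -[X in _ == X]h; apply/eqP; congr (\det _).
apply/matrixP => i j; rewrite !mxE /= /horner_eval hornerD hornerN hornerC opprK addrC.
by rewrite hornerMn hornerX.
Qed.

(** A matrix coefficient is polynomial along the line [g + x%:M], so vanishing off the roots of [m]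
    forces vanishing at [g] itself, even for singular [g]. *)
Lemma dense_shift (g : 'M[C]_N) u v (m : {poly C}) : m != 0 ->
  (forall x, m.[x] != 0 -> dot (r (g + x%:M) u) v = 0) -> dot (r g u) v = 0.
Proof.
move=> m0 h; have [p hp] := rline g u v.
suff /eqP : p * m = 0.
  rewrite mulf_eq0 (negbTE m0) orbF => /eqP p0.
  by have := hp 0; rewrite raddf0 addr0 => ->; rewrite p0 horner0.
apply: poly_eq0_pointwise => x; rewrite hornerM -hp.
by have [->|/h ->] := eqVneq m.[x] 0; rewrite ?mulr0 ?mul0r.
Qed.

Definition stable W := forall g, g \in unitmx -> forall w, w \in W -> r g w \in W.

(** The adjoint of [r g] is [r (adjmx g)], which again comes from an invertible matrix. This is how
    orthogonal complements become stable and complete reducibility is obtained. *)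
Lemma stable_orth W g b : stable W -> g \in unitmx ->
  (forall w, w \in W -> dot b w = 0) -> forall w, w \in W -> dot (r g b) w = 0.
Proof. by move=> hW gu h w wW; rewrite radj h // hW // adjmx_unit. Qed.

Section Vector.
Variables (v : V) (chi : 'rV[C]_N -> C).
Hypothesis vU : forall g, upper_unitri g -> r g v = v.
Hypothesis vT : forall t : 'rV[C]_N, (forall i, t 0 i != 0) -> r (diag_mx t) v = chi t *: v.

(* For generic g = L D U the factor L moves to the other side of the form, where its
   adjoint is upper unitriangular. *)
Lemma orth_orbit x g : (forall g, upper_unitri g -> r g x = x) -> dot v x = 0 ->
  dot (r g v) x = 0.
Proof.
move=> xU vx; have [m m0 hm] := generic_LDU_shift g.
apply: (dense_shift m0) => y /hm [L [t [U [hL ht hU ->]]]].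
rewrite !rMv vU // vT // linearZ dotZl radj xU ?vx ?mulr0 //.
exact: adjmx_lower_unitri.
Qed.

Lemma orbit_span : {W : {vspace V} | [/\ v \in W, stable W &
  forall U, v \in U -> stable U -> (W <= U)%VS] &
  forall y, (forall g, g \in unitmx -> dot (r g v) y = 0) -> forall w, w \in W -> dot w y = 0}.
Proof.
apply: cid2.
have [s hs hP] := span_predicate (fun y => exists2 g, g \in unitmx & y = r g v).
exists <<s>>%VS; last first.
  move=> y hy w ws; rewrite (coord_span (X := in_tuple s) ws) dot_suml big1 // => i _.
  have /hs [g gu ->] : (in_tuple s)`_i \in s by rewrite mem_nth.
  by rewrite dotZl hy ?mulr0.
split.
- apply: hP; exists 1%:M; first exact: unitmx1.
  by rewrite r1 lfunE.
- move=> g gu w ws; rewrite (coord_span (X := in_tuple s) ws) linear_sum /=.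
  apply: rpred_sum => i _; rewrite linearZ; apply: rpredZ; apply: hP.
  have /hs [h hu ->] : (in_tuple s)`_i \in s by rewrite mem_nth.
  by exists (g *m h); rewrite ?unitmx_mul ?gu // rMv.
- move=> U vU' hU; apply/span_subvP => y /hs [g gu ->]; exact: hU.
Qed.

(** The projection [a] of [v] to a stable [U] is fixed by upper unitriangular matrices. The part [x]
    of [a] orthogonal to [v] is then orthogonal to the whole orbit, hence to [W], which contains it;
    so [a = c *: v]. If [c != 0] then [v] lies in [U], and if [c = 0] then [U] is orthogonal to the
    orbit and vanishes. *)
Lemma orbit_span_irreducible (W : {vspace V}) : v != 0 ->
  v \in W -> stable W -> (forall U, v \in U -> stable U -> (W <= U)%VS) ->
  (forall y, (forall g, g \in unitmx -> dot (r g v) y = 0) -> forall w, w \in W -> dot w y = 0) ->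
  forall U, (U <= W)%VS -> stable U -> U = 0%VS \/ U = W.
Proof.
move=> v0 vW sW Wmin Worth U UW sU.
have [a aU ha] := orth_decomposition U v.
have unitU (g : 'M[C]_N) : upper_unitri g -> g \in unitmx.
  move=> hg; rewrite unitmxE -det_tr det_trig.
    by rewrite big1 ?unitr1 // => i _; rewrite mxE hg // eqxx.
  apply/is_trig_mxP => i j ij; rewrite mxE hg ?(ltnW ij) //.
  by case: eqP ij => // ->; rewrite ltnn.
have aUi g : upper_unitri g -> r g a = a.
  move=> hg; apply/eqP; rewrite -subr_eq0 -dot_eq0; apply/eqP.
  have gU := unitU _ hg.
  (* The left side lies in [U], and both terms on the right are orthogonal to [U]. *)
  have e : r g a - a = (v - a) - r g (v - a).
    by rewrite linearB /= vU // opprB [RHS]addrC addrA subrK.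
  have dU : r g a - a \in U by rewrite rpredB // sU.
  by rewrite {1}e dotBl ha // (stable_orth sU gU ha) // subrr.
pose c := dot a v / dot v v; pose x := a - c *: v.
have x0 : x = 0.
  apply/eqP; rewrite -dot_eq0; apply/eqP.
  apply: (Worth x); last first.
    by rewrite rpredB ?rpredZ //; apply: subvP aU.
  move=> g _; apply: orth_orbit.
    by move=> h hh; rewrite linearB linearZ /= aUi // vU.
  rewrite dotC dotBl dotZl /c divfK ?dot_eq0 // subrr; exact: conjC0.
have ac : a = c *: v by apply/eqP; rewrite -subr_eq0; apply/eqP.
have [c0|c0] := eqVneq c 0; [left|right].
  have a0 : a = 0 by rewrite ac c0 scale0r.
  apply/eqP; rewrite -subv0; apply/subvP => u uU; rewrite memv0 -dot_eq0; apply/eqP.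
  apply: (Worth u); last exact: subvP uU.
  move=> g gu; apply: (stable_orth sU gu) => // w wU.
  by rewrite -(subr0 v) -a0 ha.
apply/eqP; rewrite eqEsubv UW /=; apply: Wmin => //.
have -> : v = c^-1 *: a by rewrite ac scalerA mulVf // scale1r.
exact: rpredZ.
Qed.

End Vector.
End IrreducibleSpan.

(** * Tensor powers *)

Section KernelPower.
Variable R : comNzRingType.

(** The matrix of the [I]-fold tensor power of the linear map with matrix [K]. *)
Definition kernel_power (I X Y : finType) (K : X -> Y -> R) (s : {ffun I -> X}) (t : {ffun I -> Y}) : R :=
  \prod_i K (s i) (t i).

Lemma kernel_power_comp (I X Y Z : finType) (K : X -> Y -> R) (L : Y -> Z -> R) (s : {ffun I -> X}) u :
  \sum_t kernel_power K s t * kernel_power L t u = kernel_power (fun x z => \sum_y K x y * L y z) s u.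
Proof.
by rewrite /kernel_power bigA_distr_bigA; apply: eq_bigr => t _; rewrite big_split.
Qed.

Lemma kernel_power_apply (I X Y : finType) (K : X -> Y -> R) (f : I -> Y -> R) (s : {ffun I -> X}) :
  \sum_t kernel_power K s t * (\prod_i f i (t i)) = \prod_i \sum_y K (s i) y * f i y.
Proof.
by rewrite /kernel_power bigA_distr_bigA; apply: eq_bigr => t _; rewrite big_split.
Qed.

Lemma kernel_power_eq (I X : finType) (s t : {ffun I -> X}) :
  kernel_power (fun x y => (x == y)%:R) s t = (s == t)%:R.
Proof.
rewrite /kernel_power; have [->|/eqP st] := eqVneq s t.
  by rewrite big1 // => i _; rewrite eqxx.
have [i /eqP hi] : exists i, s i != t i.
  apply/existsP; apply: contra_notT st; rewrite negb_exists => /forallP h.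
  by apply/ffunP => i; apply/eqP; have := h i; rewrite negbK.
by rewrite (bigD1 i) //= (introF eqP hi) mul0r.
Qed.

Lemma eq_kernel_power (I X Y : finType) (K L : X -> Y -> R) (s : {ffun I -> X}) t :
  K =2 L -> kernel_power K s t = kernel_power L s t.
Proof. by move=> h; apply: eq_bigr => i _; rewrite h. Qed.

Variables (I : finType) (n : nat).

(** Indices have two levels: [I] labels the copies of a form of degree [n], and each copy has [n]
    slots, one for each tensor factor. *)
Definition tensor_kernel N N' (g : 'M[R]_(N, N')) (s : {ffun I -> {ffun 'I_n -> 'I_N}})
  (t : {ffun I -> {ffun 'I_n -> 'I_N'}}) : R := kernel_power (kernel_power (fun a b => g a b)) s t.

Lemma tensor_kernel_mul N N' N'' (g : 'M[R]_(N, N')) (h : 'M[R]_(N', N'')) s u :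
  \sum_t tensor_kernel g s t * tensor_kernel h t u = tensor_kernel (g *m h) s u.
Proof.
rewrite kernel_power_comp; apply: eq_kernel_power => a b; rewrite kernel_power_comp; apply: eq_kernel_power => c d.
by rewrite mxE.
Qed.

Lemma tensor_kernel1 N s t : tensor_kernel (1%:M : 'M[R]_N) s t = (s == t)%:R.
Proof.
rewrite -kernel_power_eq; apply: eq_kernel_power => a b; rewrite -kernel_power_eq; apply: eq_kernel_power => c d.
by rewrite mxE.
Qed.

End KernelPower.

Lemma tensor_kernel_map (R R' : comNzRingType) (f : {rmorphism R -> R'}) (I : finType) n N N'
    (g : 'M[R]_(N, N')) (s : {ffun I -> {ffun 'I_n -> 'I_N}}) t :
  f (tensor_kernel g s t) = tensor_kernel (map_mx f g) s t.
Proof.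
rewrite rmorph_prod; apply: eq_bigr => i _.
by rewrite rmorph_prod; apply: eq_bigr => k _; rewrite mxE.
Qed.

Section TensorRep.
Variables (C : numClosedFieldType) (I : finType) (n : nat).

Notation T N := {ffun {ffun I -> {ffun 'I_n -> 'I_N}} -> C^o}.

Definition tfun N N' (g : 'M[C]_(N, N')) (v : T N') : T N :=
  [ffun s => \sum_t tensor_kernel g s t * v t].

Lemma tfun_linear N N' (g : 'M[C]_(N, N')) : linear (tfun g).
Proof.
move=> a u v; apply/ffunP => s; rewrite !ffunE scaler_sumr -big_split.
by apply: eq_bigr => t _; rewrite !ffunE mulrDr mulrCA.
Qed.

HB.instance Definition _ N N' (g : 'M[C]_(N, N')) :=
  GRing.isLinear.Build C (T N') (T N) _ (tfun g) (tfun_linear g).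

Definition trep N (g : 'M[C]_N) : 'End(T N) := linfun (tfun g).

Lemma tfunM N N' N'' (g : 'M[C]_(N, N')) (h : 'M[C]_(N', N'')) v :
  tfun (g *m h) v = tfun g (tfun h v).
Proof.
apply/ffunP => s; rewrite !ffunE.
under eq_bigr do rewrite -tensor_kernel_mul mulr_suml.
rewrite exchange_big; apply: eq_bigr => t _; rewrite ffunE mulr_sumr.
by apply: eq_bigr => u _; rewrite mulrA.
Qed.

Lemma tfun1 N (v : T N) : tfun 1%:M v = v.
Proof.
apply/ffunP => s; rewrite !ffunE (bigD1 s) //= tensor_kernel1 eqxx mul1r big1 ?addr0 // => t ts.
by rewrite tensor_kernel1 eq_sym (negbTE ts) mul0r.
Qed.

Lemma tfun_adj N N' (g : 'M[C]_(N, N')) u v : dot (tfun g u) v = dot u (tfun (adjmx g) v).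
Proof.
rewrite /dot; under eq_bigr do rewrite ffunE mulr_suml.
rewrite exchange_big; apply: eq_bigr => t _.
rewrite ffunE rmorph_sum mulr_sumr; apply: eq_bigr => s _.
rewrite rmorphM /= mulrA [_ * u t]mulrC; congr (_ * _ * _).
rewrite tensor_kernel_map; apply: eq_bigr => i _; apply: eq_bigr => k _.
by rewrite !mxE /= conjCK.
Qed.

Lemma trepE N (g : 'M[C]_N) v : trep g v = tfun g v.
Proof. by rewrite lfunE. Qed.

Lemma trep1 N : trep (1%:M : 'M_N) = \1%VF.
Proof. by apply/lfunP => v; rewrite trepE tfun1 lfunE. Qed.

Lemma trepM N (g h : 'M[C]_N) : trep (g *m h) = (trep g \o trep h)%VF.
Proof. by apply/lfunP => v; rewrite comp_lfunE !trepE tfunM. Qed.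

Lemma trep_adj N (g : 'M[C]_N) u v : dot (trep g u) v = dot u (trep (adjmx g) v).
Proof. by rewrite !trepE tfun_adj. Qed.

Lemma trep_line N (g : 'M[C]_N) u v :
  exists p : {poly C}, forall x, 
    dot (trep (g + x%:M) u) v = p.[x].
Proof.
exists (\sum_s (\sum_t tensor_kernel (map_mx polyC g + 'X%:M) s t * (u t)%:P) * (Num.conj (v s))%:P).
move=> x; rewrite trepE /dot horner_sum; apply: eq_bigr => s _.
rewrite hornerM hornerC horner_sum ffunE; congr (_ * _); apply: eq_bigr => t _.
rewrite hornerM hornerC; congr (_ * _).
rewrite -[RHS]/(horner_eval x _) tensor_kernel_map; congr tensor_kernel.
by apply/matrixP => i j; rewrite !mxE /= /horner_eval hornerD hornerC hornerMn hornerX.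
Qed.

End TensorRep.

(** * Symmetric tensors of forms *)

Section SymmetricTensor.
Variables (C : numClosedFieldType) (N n : nat).
Implicit Types (s t : {ffun 'I_n -> 'I_N}) (w : {mpoly C[N]}).

Definition content s : 'X_{1..N} := s2m (codom s).

(** The polarisation of [w]: each coefficient is distributed evenly over the index functions that
    give the same monomial. *)
Definition symT w s : C := w@_(content s) / #|[set t | content t == content s]|%:R.

Lemma content_sum s : content s = (\sum_(k < n) U_(s k))%MM.
Proof.
apply/mnmP => i; rewrite mnm_sumE mnmE codomE count_map -sum1_count big_enum_cond /=.
by rewrite big_mkcond; apply: eq_bigr => k _; rewrite mnm1E /=; case: (s k == i).
Qed.

Lemma mpolyX_content s : 'X_[C, content s] = \prod_(k < n) 'X_(s k).
Proof. by rewrite content_sum (big_morph _ (@mpolyXD _ _) (@mpolyX0 _ _)). Qed.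

Lemma mdeg_content s : mdeg (content s) = n.
Proof.
by rewrite content_sum mdeg_sum (eq_bigr (fun=> 1%N)) ?sum1_card ?card_ord // => i _; rewrite mdeg1.
Qed.

Lemma content_exists (m : 'X_{1..N}) : mdeg m = n -> exists s, content s = m.
Proof.
move=> hm; have hs : size (m2s m) == n by rewrite size_m2s hm.
exists [ffun k => tnth (Tuple hs) k]; rewrite -[RHS]s2mK; congr s2m.
rewrite codomE; under eq_map do rewrite ffunE.
exact: (map_tnth_enum (Tuple hs)).
Qed.

Lemma content_perm s t : content s = content t -> exists p : 'S_n, s = [ffun k => t (p k)].
Proof.
move=> h.
have : perm_eq [tuple s k | k < n] [tuple t k | k < n].
  apply/allP => i _ /=; apply/eqP; have /mnmP/(_ i) := h.
  by rewrite !mnmE !codomE.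
case/tuple_permP => p /val_inj e; exists p; apply/ffunP => k.
by have := congr1 (fun u => tnth u k) e; rewrite ffunE !tnth_mktuple.
Qed.

Lemma content_permE t (p : 'S_n) : content [ffun k => t (p k)] = content t.
Proof.
rewrite !content_sum [RHS](reindex_inj (@perm_inj _ p)) /=.
by apply: eq_bigr => i _; rewrite ffunE.
Qed.

Lemma card_content_neq0 s : #|[set t | content t == content s]|%:R != 0 :> C.
Proof. by rewrite pnatr_eq0 -lt0n; apply/card_gt0P; exists s; rewrite inE. Qed.

Lemma symT_rep w : w \is n.-homog -> w = \sum_s symT w s *: 'X_[content s].
Proof.
move=> hw; apply/mpolyP => m; rewrite raddf_sum /=.
under eq_bigr do rewrite mcoeffZ mcoeffX.
have [hm|hm] := eqVneq (mdeg m) n; last first.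
  rewrite (dhomog_nemf_coeff hw hm) big1 // => s _.
  suff /negbTE -> : content s != m by rewrite mulr0.
  by apply: contra hm => /eqP <-; rewrite mdeg_content.
have [s <-] := content_exists hm.
rewrite (bigID (fun t => content t == content s)) /= [X in _ + X]big1 => [|t /negbTE ->]; last by rewrite mulr0.
rewrite addr0 (eq_bigr (fun=> symT w s)) => [|t /eqP ht]; last first.
  by rewrite ht eqxx mulr1 /symT ht.
by rewrite -big_set /= sumr_const -mulr_natr divfK ?card_content_neq0.
Qed.

(** Index functions of equal content differ by a permutation of the slots, so a permutation
    invariant [E] is constant on them and is determined by the coefficients of [w]. *)
Lemma symT_unique w (E : {ffun 'I_n -> 'I_N} -> C) :
  w = \sum_s E s *: 'X_[content s] ->
  (forall s (p : 'S_n), E [ffun k => s (p k)] = E s) -> forall s, symT w s = E s.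
Proof.
move=> hw hE s; rewrite /symT hw raddf_sum /=.
under eq_bigr do rewrite mcoeffZ mcoeffX.
rewrite (bigID (fun t => content t == content s)) /= [X in _ + X]big1 => [|t /negbTE ->]; last by rewrite mulr0.
rewrite addr0 (eq_bigr (fun=> E s)) => [|t /eqP ht]; last first.
  by have [p ->] := content_perm ht; rewrite content_permE eqxx mulr1 hE.
rewrite -big_set /= sumr_const -[E s *+ _]mulr_natr mulfK ?card_content_neq0 //.
Qed.

Lemma symT_perm w s (p : 'S_n) : symT w [ffun k => s (p k)] = symT w s.
Proof. by rewrite /symT content_permE. Qed.

Lemma prod_linear_forms (l : 'I_n -> 'I_N -> C) :
  \prod_i \sum_a l i a *: 'X_a = \sum_(s : {ffun 'I_n -> 'I_N}) (\prod_i l i (s i)) *: 'X_[C, content s].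
Proof.
rewrite bigA_distr_bigA /=; apply: eq_bigr => s _.
by rewrite scaler_prod mpolyX_content.
Qed.

End SymmetricTensor.

Section SymmetricTensorAction.
Variables (C : numClosedFieldType) (n : nat).

(** Expanding the substituted monomials yields a tensor invariant under slot permutations, to which
    [symT_unique] applies. The transpose in the substitution makes [g] itself act on tensors. *)
Lemma symT_subst N N' (g : 'M[C]_(N', N)) (w : {mpoly C[N]}) (s : {ffun 'I_n -> 'I_N'}) :
  w \is n.-homog ->
  symT (w \mPo [tuple \sum_(k < N') g^T j k *: 'X_k | j < N]) s
  = \sum_t kernel_power (fun a b => g a b) s t * symT w t.
Proof.
move=> hw; apply: (symT_unique (E := fun s => \sum_t kernel_power (fun a b => g a b) s t * symT w t)) => [|{}s p].
  rewrite {1}(symT_rep hw) raddf_sum /=.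
  under eq_bigr => t _.
    rewrite linearZ /= mpolyX_content rmorph_prod /=.
    under eq_bigr do rewrite comp_mpolyXU -tnth_nth tnth_mktuple.
    rewrite prod_linear_forms scaler_sumr.
  over.
  rewrite exchange_big /=; apply: eq_bigr => s' _; rewrite scaler_suml.
  apply: eq_bigr => t _; rewrite scalerA mulrC; congr (_ * _ *: _).
  by apply: eq_bigr => i _; rewrite mxE.
pose f (t : {ffun 'I_n -> 'I_N}) := [ffun k => t (p k)].
have fi : injective f.
  by move=> t t' /ffunP h; apply/ffunP => k; have := h (p^-1 k)%g; rewrite !ffunE permKV.
rewrite (reindex_inj fi) /=; apply: eq_bigr => t _; rewrite symT_perm; congr (_ * _).
rewrite [RHS](reindex_inj (@perm_inj _ p)) /=.
by apply: eq_bigr => i _; rewrite !ffunE.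
Qed.

Lemma symT_prod N (l : 'I_n -> 'I_N -> C) s :
  symT (\prod_i \sum_a l i a *: 'X_a) s
  = (n`!%:R)^-1 * \sum_(p : 'S_n) \prod_i l (p i) (s i).
Proof.
have fi (p : 'S_n) : injective (fun t : {ffun 'I_n -> 'I_N} => [ffun k => t (p k)]).
  by move=> t t' /ffunP h; apply/ffunP => k; have := h (p^-1 k)%g; rewrite !ffunE permKV.
apply: (symT_unique (E := fun s => (n`!%:R)^-1 * \sum_(p : 'S_n) \prod_i l (p i) (s i))) => [|{}s q]; last first.
  congr (_ * _); rewrite (reindex_inj (mulgI q)) /=; apply: eq_bigr => p _.
  rewrite [RHS](reindex_inj (@perm_inj _ q)) /=.
  by apply: eq_bigr => i _; rewrite ffunE permM.
rewrite prod_linear_forms.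
under [RHS]eq_bigr do rewrite mulr_sumr scaler_suml.
rewrite exchange_big /= [RHS](eq_bigr (fun=> (n`!%:R)^-1 *:
   \sum_(s : {ffun 'I_n -> 'I_N}) (\prod_i l i (s i)) *: 'X_[content s])) => [|p _].
  have e : #|{: 'S_n}| = n`! by rewrite (eq_card (B := 'S_n)) ?card_Sn.
  rewrite sumr_const e -scaler_nat scalerA mulfV ?scale1r //.
  by rewrite pnatr_eq0 -lt0n fact_gt0.
rewrite scaler_sumr (reindex_inj (fi p)) /=; apply: eq_bigr => {}s _.
rewrite content_permE scalerA; congr (_ * _ *: _).
rewrite [RHS](reindex_inj (@perm_inj _ p)) /=.
by apply: eq_bigr => i _; rewrite ffunE.
Qed.

End SymmetricTensorAction.

(** * Covariants and highest weights *)

Section PolyfunClosure.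
Variables (R : realType) (V : lmodType R[i]).
Local Notation C := R[i].
Implicit Types f g : V -> C.

Lemma polyfun_const (c : C) : polyfun (fun _ : V => c).
Proof.
exists 0%N, (fun i : 'I_0 => False_rect _ (notF (ltn_ord i))), c%:MP => v.
by rewrite mevalC.
Qed.

Lemma polyfun_scalar (l : {scalar V}) : polyfun l.
Proof. by exists 1%N, (fun _ => l), 'X_ord0 => v; rewrite mevalXU. Qed.

(** The two lists of linear forms are concatenated, so that sums and products can be formed in one
    polynomial ring. *)
Lemma polyfun_pair f g : polyfun f -> polyfun g ->
  exists m (l : 'I_m -> {scalar V}) p q,
    (forall v, f v = p.@[fun i => l i v]) /\ (forall v, g v = q.@[fun i => l i v]).
Proof.
move=> [m1 [l1 [p1 h1]]] [m2 [l2 [p2 h2]]].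
exists (m1 + m2)%N, (fun i => match split i with inl j => l1 j | inr j => l2 j end),
  (p1 \mPo [tuple 'X_(lshift m2 i) | i < m1]), (p2 \mPo [tuple 'X_(rshift m1 i) | i < m2]).
split=> v; rewrite ?h1 ?h2 comp_mpoly_meval; apply: meval_eq => i.
  by rewrite tnth_mktuple mevalXU -[lshift _ _]/(unsplit (inl i)) unsplitK.
by rewrite tnth_mktuple mevalXU -[rshift _ _]/(unsplit (inr i)) unsplitK.
Qed.

Lemma polyfun_add f g : polyfun f -> polyfun g -> polyfun (fun v => f v + g v).
Proof.
move=> hf hg; have [m [l [p [q [hp hq]]]]] := polyfun_pair hf hg.
by exists m, l, (p + q) => v; rewrite mevalD hp hq.
Qed.

Lemma polyfun_mul f g : polyfun f -> polyfun g -> polyfun (fun v => f v * g v).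
Proof.
move=> hf hg; have [m [l [p [q [hp hq]]]]] := polyfun_pair hf hg.
by exists m, l, (p * q) => v; rewrite mevalM hp hq.
Qed.

Lemma polyfun_sum (I : Type) (r : seq I) (F : I -> V -> C) :
  (forall i, polyfun (F i)) -> polyfun (fun v => \sum_(i <- r) F i v).
Proof.
move=> h; elim: r => [|i r IH].
  by under [X in polyfun X]funext do rewrite big_nil; apply: polyfun_const.
by under [X in polyfun X]funext do rewrite big_cons; apply: polyfun_add.
Qed.

Lemma polyfun_prod (I : Type) (r : seq I) (F : I -> V -> C) :
  (forall i, polyfun (F i)) -> polyfun (fun v => \prod_(i <- r) F i v).
Proof.
move=> h; elim: r => [|i r IH].
  by under [X in polyfun X]funext do rewrite big_nil; apply: polyfun_const.
by under [X in polyfun X]funext do rewrite big_cons; apply: polyfun_mul.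
Qed.

Lemma polyfun_linear (l : V -> C) : linear_for *%R l -> polyfun l.
Proof.
move=> hl; pose L := GRing.isLinear.Build C V C *%R l hl.
pose l' : {scalar V} := HB.pack l L.
exact: (polyfun_scalar l').
Qed.

End PolyfunClosure.

Section Covariant.
Variables (R : realType) (N n : nat) (I : finType).
Local Notation C := R[i].
Local Notation Pol := (dhomog N C n).
Local Notation T := {ffun {ffun I -> {ffun 'I_n -> 'I_N}} -> C^o}.

Definition power_tensor (w : Pol) : T := [ffun t : {ffun I -> {ffun 'I_n -> 'I_N}} => \prod_b symT w (t b)].

Lemma power_tensor_act g w : power_tensor (form_act g w) = trep I n g (power_tensor w).
Proof.
rewrite trepE; apply/ffunP => s; rewrite !ffunE.
under [RHS]eq_bigr do rewrite ffunE.
refine (eq_trans _ (esym (kernel_power_apply (kernel_power (fun a b => g a b)) (fun=> symT w) s))).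
apply: eq_bigr => b _; rewrite -symT_subst //.
exact: dhomog_is_dhomog.
Qed.

Lemma polyfun_entry (i j : 'I_N) : polyfun (fun g : 'M[C]_N => g i j).
Proof. by apply: polyfun_linear => a u v; rewrite !mxE. Qed.

Lemma polyfun_power_tensor t : polyfun (fun w => power_tensor w t).
Proof.
under [X in polyfun X]funext do rewrite ffunE.
apply: polyfun_prod => b; apply: polyfun_linear => a u v.
rewrite /symT.
have -> : (mpoly_of_dhomog (a *: u + v)) = a *: mpoly_of_dhomog u + mpoly_of_dhomog v by exact: linearP.
by rewrite mcoeffD mcoeffZ mulrDl mulrA.
Qed.

Lemma polyfun_covariant (l : {linear T -> C^o}) : polyfun (fun w => l (power_tensor w)).
Proof.
under [X in polyfun X]funext do rewrite linear_expand.
by apply: polyfun_sum => t; apply: polyfun_mul; [exact: polyfun_power_tensor|exact: polyfun_const].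
Qed.

Lemma polyfun_trep (l : {linear T -> C^o}) v : polyfun (fun g => l (trep I n g v)).
Proof.
under [X in polyfun X]funext do rewrite linear_expand.
apply: polyfun_sum => t; apply: polyfun_mul; last exact: polyfun_const.
under [X in polyfun X]funext do rewrite trepE ffunE.
apply: polyfun_sum => s; apply: polyfun_mul; last exact: polyfun_const.
apply: polyfun_prod => b; apply: polyfun_prod => k; exact: polyfun_entry.
Qed.

Section Criterion.
Variables (Z : set Pol) (w0 : Pol) (lambda : 'rV[int]_N) (v : T).
Hypothesis orbZ : (form_orbit w0 `<=` Z)%classic.
Hypothesis dom : dominant lambda.
Hypothesis vU : forall g, upper_unitri g -> trep I n g v = v.
Hypothesis vT : forall t : 'rV[C]_N, (forall i, t 0 i != 0) ->
  trep I n (diag_mx t) v = (\prod_i t 0 i ^ lambda 0 i) *: v.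

Let rline g (u u' : T) : exists p : {poly C}, forall x, dot (trep I n (g + x%:M) u) u' = p.[x].
Proof. exact: trep_line. Qed.

Local Notation r := (@trep C I n N).

Definition sub_rep (W : {vspace T}) (g : 'M[C]_N) : 'End(subvs_of W) :=
  linfun (vsproj W \o r g \o vsval).

Lemma sub_repE (W : {vspace T}) g u : sub_rep W g u = vsproj W (r g (vsval u)).
Proof. by rewrite lfunE. Qed.

Lemma sub_rep_rational (W : {vspace T}) : stable r W -> rational_module (sub_rep W).
Proof.
move=> sW; split.
- by apply/lfunP => u; rewrite sub_repE trep1 !lfunE /= vsvalK.
- move=> g h gu hu; apply/lfunP => u; rewrite comp_lfunE !sub_repE trepM comp_lfunE.
  by rewrite [in RHS]vsprojK // sW // subvsP.
move=> l u; exists (fun g => l (sub_rep W g u)), 0%N; split; last first.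
  by move=> g _; rewrite expr0 divr1.
under [X in polyfun X]funext do rewrite sub_repE.
exact: (polyfun_trep (l \o vsproj W)).
Qed.

Lemma sub_rep_irreducible (W : {vspace T}) : stable r W -> v \in W -> v != 0 ->
  (forall U, (U <= W)%VS -> stable r U -> U = 0%VS \/ U = W) ->
  irreducible_module (sub_rep W).
Proof.
move=> sW vW v0 Wirr; split.
  apply: contra v0 => /eqP h.
  have : vsproj W v \in {: subvs_of W}%VS by rewrite memvf.
  rewrite h memv0 => /eqP /(congr1 vsval); rewrite vsprojK // => ->.
  by rewrite linear0.
move=> U hU; pose i := linfun (vsval : subvs_of W -> T).
have iE u : i u = vsval u by rewrite lfunE.
have [|||e] := Wirr (i @: U)%VS.
- by apply/subvP => _ /memv_imgP [u _ ->]; rewrite iE subvsP.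
- move=> g gu _ /memv_imgP [u uU ->]; rewrite iE.
  have -> : r g (vsval u) = i (sub_rep W g u).
    by rewrite iE sub_repE vsprojK // sW // subvsP.
  by rewrite memv_img //; apply: subvP (hU g gu) _ _; rewrite memv_img.
- move=> e; left; apply/eqP; rewrite -subv0; apply/subvP => u uU; rewrite memv0.
  have : i u \in (i @: U)%VS by rewrite memv_img.
  by rewrite e memv0 iE => /eqP h; apply/eqP/subvs_inj; rewrite h linear0.
right; apply/eqP; rewrite eqEsubv subvf; apply/subvP => u _.
have : vsval u \in (i @: U)%VS by rewrite e subvsP.
by case/memv_imgP => u' uU; rewrite iE => /subvs_inj ->.
Qed.

(** The module is the span [W] of the orbit of [v], and a functional [phi] on [W] is sent to the
    function evaluating it at the projection of [power_tensor z] to [W]. The projection [P] is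
    equivariant because the orthogonal complement of [W] is stable. *)
Lemma highest_weights_criterion (g0 : 'M[C]_N) :
  dot (power_tensor (form_act g0 w0)) v != 0 -> highest_weights Z lambda.
Proof.
move=> nz0.
(* The matrix [g0] may be singular; by density the pairing is also nonzero at some invertible
   matrix, that is, on the orbit. *)
have [g1 g1u nz1] : exists2 g1, g1 \in unitmx & dot (power_tensor (form_act g1 w0)) v != 0.
  apply: contrapT => h; move/eqP: nz0; apply.
  have [m m0 hm] := det_shift_poly g0; rewrite power_tensor_act.
  apply: (dense_shift rline m0) => x /hm gu; rewrite -power_tensor_act.
  by apply/eqP; apply: contraT => ?; case: h; exists (g0 + x%:M).
have v0 : v != 0 by apply: contra nz1 => /eqP ->; rewrite dot0r.
have [W [vW sW Wmin] Worth] := orbit_span (@trep1 C I n N) (@trepM C I n N) v.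
have Wirr := orbit_span_irreducible (@trepM C I n N) (@trep_adj C I n N) rline vU vT
  v0 vW sW Wmin Worth.
have [Wp hWp] := orth_complement W.
have [capW sumW] := orth_sum hWp.
pose P := daddv_pi W Wp.
have PW u : P u \in W by rewrite memv_pi.
have Pid u : u \in W -> P u = u by move=> uW; rewrite /P daddv_pi_id.
have dec u : u - P u \in Wp.
  have := @daddv_pi_add _ _ W Wp u capW; rewrite sumW memvf => /(_ isT) {1}<-.
  by rewrite addrC addKr memv_pi.
have Pp u : u \in Wp -> P u = 0.
  move=> uW; apply/eqP; rewrite -memv0 -capW memv_cap PW /=.
  by rewrite -(subKr u (P u)) rpredB ?dec.
have Pr g u : g \in unitmx -> P (r g u) = r g (P u).
  move=> gu; have -> : r g u = r g (u - P u) + r g (P u) by rewrite -linearD subrK.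
  rewrite linearD /= [X in _ + X]Pid ?sW // Pp ?add0r //; apply/hWp => w wW.
  apply: (stable_orth (@trep_adj C I n N) sW) => //; first exact/hWp.
split=> //; exists (subvs_of W), (sub_rep W); split.
  split; [exact: sub_rep_rational | exact: sub_rep_irreducible |].
  exists (vsproj W v); split.
  - by apply: contra v0 => /eqP /(congr1 vsval); rewrite vsprojK // => ->; rewrite linear0.
  - by move=> g gU; rewrite sub_repE vsprojK // vU.
  - by move=> t ht; rewrite sub_repE vsprojK // vT // linearZ.
exists (fun phi z => phi (vsproj W (P (power_tensor z)))); split.
- move=> phi; exact: (polyfun_covariant (phi \o vsproj W \o P)).
- by move=> a phi psi z _; rewrite add_lfunE scale_lfunE.
- move=> g phi z gu _; rewrite power_tensor_act Pr ?unitmx_inv // comp_lfunE sub_repE.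
  by rewrite vsprojK.
move=> phi hphi; pose y := P (power_tensor (form_act g1 w0)).
have y0 : y != 0.
  apply: contra nz1 => /eqP y0.
  by have /hWp/(_ v vW) := dec (power_tensor (form_act g1 w0)); rewrite -/y y0 subr0 => ->.
(* Injectivity: by irreducibility the translates of the nonzero vector [y] span [W], and a [phi]
   whose function vanishes on [Z] kills all of them. *)
have [s hs hP] := span_predicate (fun u => exists2 g, g \in unitmx & u = r g y).
have sS : stable r <<s>>%VS.
  move=> g gu w ws; rewrite (coord_span (X := in_tuple s) ws) linear_sum /=.
  apply: rpred_sum => i _; rewrite linearZ; apply: rpredZ; apply: hP.
  have /hs [h hu ->] : (in_tuple s)`_i \in s by rewrite mem_nth.
  by exists (g *m h); rewrite ?unitmx_mul ?gu // trepM comp_lfunE.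
have SW : (<<s>> <= W)%VS.
  by apply/span_subvP => _ /hs [g gu ->]; rewrite sW // PW.
have [e|e] := Wirr _ SW sS.
  have : y \in <<s>>%VS by apply: hP; exists 1%:M; rewrite ?unitmx1 // trep1 lfunE.
  by rewrite e memv0 (negbTE y0).
apply/lfunP => u; transitivity (0 : R[i]); last by rewrite [RHS]lfunE.
rewrite -(vsvalK u).
have : vsval u \in <<s>>%VS by rewrite e subvsP.
move=> us; rewrite (coord_span (X := in_tuple s) us) !linear_sum big1 // => i _.
rewrite !linearZ.
have /hs [g gu ->] : (in_tuple s)`_i \in s by rewrite mem_nth.
rewrite /y power_tensor_act -Pr // -[r g (r g1 _)]comp_lfunE -trepM -power_tensor_act; apply/eqP; rewrite scaler_eq0; apply/orP; right; apply/eqP.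
apply: hphi; apply: orbZ; by exists (g *m g1); first by rewrite unitmx_mul gu.
Qed.

End Criterion.
End Covariant.

(** * Finiteness over the coefficients of products of linear forms *)

Section HomogeneousFunctions.
Variables (C : fieldType) (Om : Type) (A : finType).
Implicit Types (f h : Om -> C).

(** Homogeneity of degree [d] in the generators [beta], as functions on [Om]. Only the existence of
    such an expression is recorded, since the generators may satisfy relations. *)
Definition hform (beta : Om -> A -> C) d f : Prop :=
  exists y : {ffun 'I_d -> A} -> C, forall l, f l = \sum_t y t * \prod_s beta l (t s).

Variable beta : Om -> A -> C.
Notation hom := (hform beta).

Lemma hform_ext d f h : f =1 h -> hom d f -> hom d h.
Proof. by move=> fh [y hy]; exists y => l; rewrite -fh. Qed.

Lemma hform_zero d : hom d (fun=> 0).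
Proof. by exists (fun=> 0) => l; rewrite big1 // => t _; rewrite mul0r. Qed.

Lemma hform_add d f h : hom d f -> hom d h -> hom d (fun l => f l + h l).
Proof.
move=> [y hy] [z hz]; exists (fun t => y t + z t) => l.
by rewrite hy hz -big_split; apply: eq_bigr => t _; rewrite mulrDl.
Qed.

Lemma hform_scale d c f : hom d f -> hom d (fun l => c * f l).
Proof.
move=> [y hy]; exists (fun t => c * y t) => l.
by rewrite hy mulr_sumr; apply: eq_bigr => t _; rewrite mulrA.
Qed.

Lemma hform_sum d (I : Type) (r : seq I) (P : pred I) (F : I -> Om -> C) :
  (forall i, P i -> hom d (F i)) -> hom d (fun l => \sum_(i <- r | P i) F i l).
Proof.
move=> h; elim: r => [|i r IH].
  by apply: hform_ext (hform_zero d) => l; rewrite big_nil.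
case Pi : (P i); last by apply: hform_ext IH => l; rewrite big_cons Pi.
by apply: hform_ext (hform_add (h _ Pi) IH) => l; rewrite big_cons Pi.
Qed.

Lemma hform_const c : hom 0 (fun=> c).
Proof.
exists (fun=> c) => l; rewrite (eq_bigr (fun=> c)) => [|t _]; last by rewrite big_ord0 mulr1.
by rewrite sumr_const (eq_card (B := {: {ffun 'I_0 -> A}})) // card_ffun card_ord expn0.
Qed.

Lemma hform_gen a : hom 1 (fun l => beta l a).
Proof.
exists (fun t => (t == [ffun=> a])%:R) => l.
rewrite (bigD1 [ffun=> a]) //= eqxx mul1r [X in _ + X]big1; last by move=> t /negbTE ->; rewrite mul0r.
by rewrite addr0 big_ord1 ffunE.
Qed.

Lemma hform_mul d e f h : hom d f -> hom e h -> hom (d + e) (fun l => f l * h l).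
Proof.
move=> [y hy] [z hz].
pose L (t : {ffun 'I_(d + e) -> A}) := [ffun i : 'I_d => t (lshift e i)].
pose Rr (t : {ffun 'I_(d + e) -> A}) := [ffun i : 'I_e => t (rshift d i)].
exists (fun t => y (L t) * z (Rr t)) => l.
rewrite hy hz big_distrlr /= pair_big /=.
pose G (p : {ffun 'I_d -> A} * {ffun 'I_e -> A}) : {ffun 'I_(d + e) -> A} :=
  [ffun k => match split k with inl i => p.1 i | inr i => p.2 i end].
have LG p : L (G p) = p.1.
  by apply/ffunP => i; rewrite !ffunE -[lshift _ _]/(unsplit (inl i)) unsplitK.
have RG p : Rr (G p) = p.2.
  by apply/ffunP => i; rewrite !ffunE -[rshift _ _]/(unsplit (inr i)) unsplitK.
have GK t : G (L t, Rr t) = t.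
  apply/ffunP => k; rewrite ffunE; case: splitP => i ki; rewrite ffunE; congr (t _);
  exact: val_inj.
have Gb : bijective G.
  by exists (fun t => (L t, Rr t)) => // p; rewrite LG RG; case: p.
rewrite [RHS](reindex G) /=; last exact: onW_bij.
apply: eq_bigr => p _; rewrite LG RG big_split_ord /= mulrACA; congr (_ * (_ * _)).
  by apply: eq_bigr => i _; rewrite -[in LHS](LG p) ffunE.
by apply: eq_bigr => i _; rewrite -[in LHS](RG p) ffunE.
Qed.

Lemma hform_exp d f k : hom d f -> hom (k * d) (fun l => f l ^+ k).
Proof.
move=> hf; elim: k => [|k IH]; first by rewrite mul0n; apply: hform_const.
rewrite mulSn; apply: hform_ext (hform_mul hf IH) => l; by rewrite exprS.
Qed.

Lemma hform_big_prod (I : Type) (r : seq I) (F : I -> Om -> C) :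
  (forall i, hom 1 (F i)) -> hom (size r) (fun l => \prod_(i <- r) F i l).
Proof.
move=> h; elim: r => [|i r IH].
  by apply: hform_ext (hform_const 1) => l; rewrite big_nil.
by apply: hform_ext (hform_mul (h i) IH) => l; rewrite big_cons.
Qed.

Definition gen_monomial (s : seq A) (l : Om) : C := \prod_(a <- s) beta l a.

Lemma hform_mono s : hom (size s) (gen_monomial s).
Proof. by apply: hform_big_prod => a; apply: hform_gen. Qed.

Lemma gen_monomial_cat s r l : gen_monomial (s ++ r) l = gen_monomial s l * gen_monomial r l.
Proof. exact: big_cat. Qed.

Lemma gen_monomial_cons a s l : gen_monomial (a :: s) l = beta l a * gen_monomial s l.
Proof. exact: big_cons. Qed.

Lemma gen_monomial_perm s r l : perm_eq s r -> gen_monomial s l = gen_monomial r l.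
Proof. exact: perm_big. Qed.

Lemma gen_monomial_codom d (t : {ffun 'I_d -> A}) l : \prod_s beta l (t s) = gen_monomial (codom t) l.
Proof. by rewrite /gen_monomial codomE big_map enumT. Qed.

End HomogeneousFunctions.

Lemma hform_comp (C : fieldType) Om (A A' : finType) (beta : Om -> A -> C) (gamma : Om -> A' -> C) d f :
  (forall a, hform beta 1 (fun l => gamma l a)) -> hform gamma d f -> hform beta d f.
Proof.
move=> hg [y hy].
have : hform beta d (fun l => \sum_t y t * gen_monomial gamma (codom t) l).
  apply: hform_sum => t _; apply: hform_scale.
  have := hform_big_prod (codom t) hg; rewrite size_codom card_ord; exact.
by apply: hform_ext => l; rewrite hy; apply: eq_bigr => t _; rewrite gen_monomial_codom.
Qed.

(** * Homogeneity of the coefficients of a characteristic polynomial *)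

Section CharPolyHomogeneous.
Variables (C : fieldType) (Om : Type) (A : finType) (Z : Om -> A -> C) (D : nat).

(** Weighted homogeneity of total degree [m * D], where the indeterminate has weight [D]. *)
Definition graded_poly m (F : Om -> {poly C}) : Prop :=
  forall i, ((i <= m)%N -> hform Z ((m - i) * D) (fun l => (F l)`_i)) /\
            ((m < i)%N -> forall l, (F l)`_i = 0).

Lemma graded_poly_mul m m' F G : graded_poly m F -> graded_poly m' G ->
  graded_poly (m + m') (fun l => F l * G l).
Proof.
move=> hF hG i; split=> hi.
  apply: (@hform_ext _ _ _ _ _ (fun l => \sum_(k < i.+1) (F l)`_k * (G l)`_(i - k))).
    by move=> l; rewrite coefM.
  apply: hform_sum => k _.
  have [km|km] := leqP k m; last first.
    by apply: hform_ext (hform_zero _ _) => l; have [_ ->] := hF k; rewrite ?mul0r.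
  have [im|im] := leqP (i - k) m'; last first.
    by apply: hform_ext (hform_zero _ _) => l; have [_ ->] := hG (i - k)%N; rewrite ?mulr0.
  have ki : (k <= i)%N by rewrite -ltnS.
  have -> : ((m + m' - i) * D = (m - k) * D + (m' - (i - k)) * D)%N.
    by rewrite -mulnDl; congr (_ * _)%N; lia.
  by apply: hform_mul; [have [h _] := hF k | have [h _] := hG (i - k)%N]; apply: h.
move=> l; rewrite coefM big1 // => k _.
have [km|km] := leqP k m; last by have [_ ->] := hF k; rewrite ?mul0r.
have [_ ->] := hG (i - k)%N; rewrite ?mulr0 //.
by rewrite ltn_subRL; apply: leq_ltn_trans hi; rewrite leq_add2r.
Qed.

Lemma graded_poly_sum m (I : Type) (r : seq I) (F : I -> Om -> {poly C}) :
  (forall i, graded_poly m (F i)) -> graded_poly m (fun l => \sum_(i <- r) F i l).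
Proof.
move=> h i; split=> hi.
  apply: (@hform_ext _ _ _ _ _ (fun l => \sum_(k <- r) (F k l)`_i)).
    by move=> l; rewrite coef_sum.
  by apply: hform_sum => k _; have [hk _] := h k i; apply: hk.
by move=> l; rewrite coef_sum big1 // => k _; have [_ ->] := h k i.
Qed.

Lemma graded_poly_const (c : C) : graded_poly 0 (fun=> c%:P).
Proof.
move=> i; split=> [|hi l]; last by rewrite coefC -(negbK (i == 0)%N) -lt0n hi.
rewrite leqn0 => /eqP ->; rewrite mul0n.
by apply: hform_ext (hform_const _ c) => l; rewrite coefC.
Qed.

Lemma graded_poly_prod (I : Type) (r : seq I) (F : I -> Om -> {poly C}) :
  (forall i, graded_poly 1 (F i)) -> graded_poly (size r) (fun l => \prod_(i <- r) F i l).
Proof.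
move=> h; elim: r => [|i r IH] /=.
  by have := graded_poly_const 1; congr graded_poly; apply/funext => l; rewrite big_nil.
have := graded_poly_mul (h i) IH; rewrite add1n; congr graded_poly.
by apply/funext => l; rewrite big_cons.
Qed.

Lemma char_poly_hform r (M : Om -> 'M[C]_r) :
  (forall i k, hform Z D (fun l => M l i k)) ->
  forall i, (i <= r)%N -> hform Z ((r - i) * D) (fun l => (char_poly (M l))`_i).
Proof.
move=> hM; suff h : graded_poly r (fun l => char_poly (M l)).
  by move=> i hi; have [h' _] := h i; apply: h'.
have entry i k : graded_poly 1 (fun l => char_poly_mx (M l) i k).
  case=> [|[|d]]; split=> // _.
  - rewrite subn0 mul1n; apply: hform_ext (hform_scale (-1) (hM i k)) => l.
    by rewrite !mxE coefB coefMn coefX coefC /= mul0rn sub0r mulN1r.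
  - rewrite subnn mul0n; apply: hform_ext (hform_const _ (i == k)%:R) => l.
    by rewrite !mxE coefB coefMn coefX coefC /= subr0.
  - by move=> l; rewrite !mxE coefB coefMn coefX coefC /= mul0rn subr0.
rewrite /char_poly /determinant; apply: graded_poly_sum => s.
rewrite -[r in graded_poly r]add0n; apply: graded_poly_mul.
  have := graded_poly_const ((-1) ^+ s); congr graded_poly.
  by apply/funext => l; rewrite rmorphXn rmorphN1.
rewrite -[r in graded_poly r](size_enum_ord r).
rewrite (_ : (fun l => _) = fun l => \prod_(i <- enum 'I_r) char_poly_mx (M l) i (s i)).
  by apply: graded_poly_prod.
by apply/funext => l; rewrite enumT.
Qed.

End CharPolyHomogeneous.

(** * Integrality over the coefficients of a product of linear forms *)

Section ProductsOfLinearForms.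
Variables (C : numFieldType) (n j : nat).
Local Notation A := {ffun 'I_n -> 'I_j}.
Local Notation Om := 'M[C]_(n, j).
Implicit Types (a k : A) (l : Om) (p : 'S_n).

(** The rows of [l] are the coefficient vectors of [n] linear forms; these are the multilinear
    monomials b_a in the rows. *)
Definition entry_prod l a : C := \prod_i l i (a i).

(** Up to a nonzero scalar, the coefficient of the product of the linear forms at the monomial
    indexed by [k]. *)
Definition perm_tensor l k : C := \sum_(p : 'S_n) \prod_i l (p i) (k i).

Local Notation b := entry_prod.
Local Notation Z := perm_tensor.
Local Notation hom := (hform entry_prod).
Local Notation mon := (gen_monomial entry_prod).

Definition shuffle a p : A := [ffun i => a (p^-1 i)%g].

Lemma perm_tensorE l k : Z l k = \sum_p b l (shuffle k p).
Proof.
apply: eq_bigr => p _; rewrite /b [RHS](reindex_inj (@perm_inj _ p)) /=.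
by apply: eq_bigr => i _; rewrite ffunE permK.
Qed.

Lemma hform_perm_tensor k : hom 1 (fun l => Z l k).
Proof.
apply: (@hform_ext _ _ _ _ _ (fun l => \sum_p b l (shuffle k p))) => [l|].
  by rewrite perm_tensorE.
by apply: hform_sum => p _; apply: hform_gen.
Qed.

Definition index_sum a : nat := \sum_i a i.
Definition amin a a' : A := [ffun i => if (a i <= a' i)%N then a i else a' i].
Definition amax a a' : A := [ffun i => if (a i <= a' i)%N then a' i else a i].

Lemma entry_prod_minmax l a a' : b l a * b l a' = b l (amin a a') * b l (amax a a').
Proof.
rewrite /b -!big_split /=; apply: eq_bigr => i _; rewrite !ffunE.
by case: ifP => // _; rewrite mulrC.
Qed.

Lemma index_sum_shuffle a p : index_sum (shuffle a p) = index_sum a.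
Proof.
rewrite /index_sum [RHS](reindex_inj (@perm_inj _ p^-1)) /=.
by apply: eq_bigr => i _; rewrite ffunE.
Qed.

(** If the minimum had the same sum as [a], then [a] would lie below its shuffle in every position,
    and equality of their sums would make them equal. *)
Lemma index_sum_amin a p : shuffle a p != a -> (index_sum (amin a (shuffle a p)) < index_sum a)%N.
Proof.
set a' := shuffle a p => ne; rewrite ltnNge; apply: contra ne => le.
have le1 i : (amin a a' i <= a i)%N.
  by rewrite ffunE; case: ifP => // /negbT; rewrite -ltnNge => /ltnW.
have e1 i : amin a a' i = a i :> nat.
  have := leqif_sum (fun i (_ : true) => leqif_eq (le1 i)).
  case=> _; rewrite -/(index_sum _) -/(index_sum _) => /esym; rewrite eqn_leq le andbT leq_sum // => /forallP h.
  exact/eqP/h.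
have le2 i : (a i <= a' i)%N.
  by rewrite -e1 ffunE; case: ifP => // /negbT; rewrite -ltnNge.
have := leqif_sum (fun i (_ : true) => leqif_eq (le2 i)).
case=> _; rewrite -/(index_sum _) -/(index_sum _) index_sum_shuffle eqxx => /esym /forallP h.
by apply/eqP/ffunP => i; apply/val_inj/esym/eqP/h.
Qed.

(* [d] is the degree of [f]; the truncation in [d.-1] makes this meaningful only for [0 < d]. *)
Definition in_ideal d (f : Om -> C) : Prop :=
  exists2 g : A -> Om -> C, (forall k, hom d.-1 (g k)) & forall l, f l = \sum_k Z l k * g k l.

Lemma in_ideal_ext d f h : f =1 h -> in_ideal d f -> in_ideal d h.
Proof. by move=> fh [g hg e]; exists g => // l; rewrite -fh. Qed.

Lemma in_ideal_add d f h : in_ideal d f -> in_ideal d h -> in_ideal d (fun l => f l + h l).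
Proof.
move=> [g hg e] [g' hg' e']; exists (fun k l => g k l + g' k l) => [k|l].
  exact: hform_add.
by rewrite e e' -big_split; apply: eq_bigr => k _; rewrite mulrDr.
Qed.

Lemma in_ideal_scale d c f : in_ideal d f -> in_ideal d (fun l => c * f l).
Proof.
move=> [g hg e]; exists (fun k l => c * g k l) => [k|l]; first exact: hform_scale.
by rewrite e mulr_sumr; apply: eq_bigr => k _; rewrite mulrCA.
Qed.

Lemma in_ideal_sum d (I : Type) (r : seq I) (P : pred I) (F : I -> Om -> C) :
  (forall i, P i -> in_ideal d (F i)) -> in_ideal d (fun l => \sum_(i <- r | P i) F i l).
Proof.
move=> h; elim: r => [|i r IH].
  exists (fun _ _ => 0) => [k|l]; first exact: hform_zero.
  by rewrite big_nil big1 // => k _; rewrite mulr0.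
case Pi : (P i); last by apply: in_ideal_ext IH => l; rewrite big_cons Pi.
by apply: in_ideal_ext (in_ideal_add (h _ Pi) IH) => l; rewrite big_cons Pi.
Qed.

Lemma in_ideal_mul d e f h : (0 < d)%N -> in_ideal d f -> hom e h -> in_ideal (d + e) (fun l => f l * h l).
Proof.
case: d => // d _ [g hg ef] hh; exists (fun k l => g k l * h l) => [k|l].
  by rewrite addSn; apply: hform_mul.
by rewrite ef mulr_suml; apply: eq_bigr => k _; rewrite mulrA.
Qed.

Lemma in_ideal_gen d k h : hom d h -> in_ideal d.+1 (fun l => Z l k * h l).
Proof.
move=> hh; exists (fun k' l => (k' == k)%:R * h l) => [k'|l]; first exact: hform_scale.
rewrite (bigD1 k) //= eqxx mul1r big1 ?addr0 // => k' /negbTE ->.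
by rewrite mul0r mulr0.
Qed.

(** The form in which nilpotency of the b_a modulo the ideal is proved, by induction on [w]. *)
Definition absorbed w N := forall s : seq A, all (fun a => index_sum a < w)%N s -> (N <= size s)%N ->
  in_ideal (size s) (mon s).

(** Expand [Z l a * b l a] over permutations: those fixing [a] give the square, the others are
    rewritten by [entry_prod_minmax]. The constant is the order of the stabiliser of [a], nonzero in
    characteristic 0. *)
Lemma square_reduction a : exists2 c : C, c != 0 & forall l,
  c * b l a ^+ 2 = Z l a * b l a -
    \sum_(p | shuffle a p != a) b l (amin a (shuffle a p)) * b l (amax a (shuffle a p)).
Proof.
exists (#|[set p | shuffle a p == a]|%:R).
  rewrite pnatr_eq0 -lt0n; apply/card_gt0P; exists 1%g; rewrite inE.
  by apply/eqP/ffunP => i; rewrite ffunE invg1 perm1.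
move=> l; rewrite perm_tensorE mulr_suml (bigID (fun p => shuffle a p == a)) /=.
rewrite [X in _ + X - _](eq_bigr (fun p =>
  b l (amin a (shuffle a p)) * b l (amax a (shuffle a p)))) => [|p _]; last first.
  rewrite [LHS]mulrC; exact: entry_prod_minmax.
rewrite addrK (eq_bigr (fun=> b l a ^+ 2)) => [|p /eqP ->]; last by rewrite expr2.
by rewrite -big_set /= sumr_const mulr_natl.
Qed.

(** Modulo the ideal, a pair of factors b_a is exchanged for a minimum, of smaller index sum and
    stored in [s], and a maximum, stored in [r]. After [c] exchanges [s] is long enough for
    [absorbed w N]. *)
Lemma reduce_duplicates w N a : (0 < N)%N -> absorbed w N -> index_sum a = w ->
  forall c s r, all (fun a => index_sum a < w)%N s -> (N <= size s + c)%N ->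
  in_ideal (c.*2 + size s + size r) (mon (nseq c.*2 a ++ s ++ r)).
Proof.
move=> N0 hN wa; elim=> [|c IH] s r hs hc.
  rewrite addn0 in hc; rewrite double0 add0n.
  apply: in_ideal_ext (in_ideal_mul (leq_trans N0 hc) (hN _ hs hc) (hform_mono _ r)) => l.
  by rewrite /= gen_monomial_cat.
have [d d0 hd] := square_reduction a.
pose rest l := mon (nseq c.*2 a ++ s ++ r) l.
pose red p l := mon (nseq c.*2 a ++ (amin a (shuffle a p) :: s) ++ (amax a (shuffle a p) :: r)) l.
have sz : ((c.+1).*2 + size s + size r = (c.*2 + (size s).+1 + (size r).+1))%N by lia.
have main : in_ideal (c.+1.*2 + size s + size r) (fun l => d^-1 * (Z l a * (b l a * rest l) +
    (-1) * \sum_(p | shuffle a p != a) red p l)).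
  apply: in_ideal_scale; apply: in_ideal_add; last first.
    apply: in_ideal_scale; apply: in_ideal_sum => p hp; rewrite sz; apply: (IH (_ :: s) (_ :: r)) => /=.
      by rewrite hs -wa index_sum_amin.
    by rewrite addSnnS.
  rewrite (_ : (_ + _)%N = (1 + (c.*2 + (size s + size r))).+1); last lia.
  apply: in_ideal_gen; apply: hform_mul; first exact: hform_gen.
  by have := hform_mono entry_prod (nseq c.*2 a ++ s ++ r); rewrite !size_cat size_nseq.
apply: in_ideal_ext main => l; rewrite mulN1r.
have -> : \sum_(p | shuffle a p != a) red p l =
    (\sum_(p | shuffle a p != a) b l (amin a (shuffle a p)) * b l (amax a (shuffle a p))) * rest l.
  rewrite mulr_suml; apply: eq_bigr => p _; rewrite /red /rest !gen_monomial_cat !gen_monomial_cons.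
  by rewrite mulrACA [in RHS]mulrCA.
rewrite mulrA -mulrBl -hd -mulrA mulKf //.
by rewrite doubleS /rest expr2 -mulrA !gen_monomial_cons.
Qed.

(** Pigeonhole: a monomial with [N + #|A| * N.*2] factors has [N] factors of index sum below [w], or
    contains a single b_a of index sum [w] at least [N.*2] times. *)
Lemma long_monomials_absorbed w : exists2 N, (0 < N)%N & absorbed w N.
Proof.
elim: w => [|w [N N0 hN]].
  by exists 1%N => // s; case: s => //= a s; rewrite ltn0.
exists (N + #|A| * N.*2)%N => [|s hs sz]; first by rewrite addn_gt0 N0.
pose lo := [pred a | (index_sum a < w)%N].
have perm_lo : perm_eq s (filter lo s ++ filter (predC lo) s) by rewrite perm_sym perm_filterC.
have szs : size s = (size (filter lo s) + size (filter (predC lo) s))%N.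
  by rewrite (perm_size perm_lo) size_cat.
have all_lo : all (fun a => index_sum a < w)%N (filter lo s) by apply: filter_all.
have [big|small] := leqP N (size (filter lo s)).
  rewrite szs; apply: in_ideal_ext (in_ideal_mul (leq_trans N0 big) (hN _ all_lo big)
    (hform_mono _ (filter (predC lo) s))) => l.
  by rewrite (gen_monomial_perm _ _ perm_lo) gen_monomial_cat.
have [a ha] : exists a, (N.*2 <= count_mem a (filter (predC lo) s))%N.
  apply/existsP; apply: contraT; rewrite negb_exists => /forallP h.
  have : (size (filter (predC lo) s) <= #|A| * N.*2)%N.
    rewrite -sum1_size (partition_big id predT) //= -sum_nat_const.
    apply: leq_sum => a _; have := h a; rewrite -ltnNge => /ltnW.
    by rewrite -sum1_count.
  lia.
have wa : index_sum a = w.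
  have : a \in filter (predC lo) s.
    by rewrite -has_pred1 has_count; apply: leq_trans ha; rewrite double_gt0.
  rewrite mem_filter /= -leqNgt => /andP [wa a_s].
  by apply/eqP; rewrite eqn_leq wa andbT -ltnS; move/allP: hs => /(_ a a_s).
have cs : (N.*2 <= count_mem a s)%N.
  apply: leq_trans ha _; rewrite (seq.permP perm_lo) count_cat leq_addl //.
pose rs := nseq (count_mem a s - N.*2) a ++ filter (predC (pred1 a)) s.
have ps : perm_eq s (nseq N.*2 a ++ [::] ++ rs).
  rewrite /= /rs catA -nseqD subnKC // -size_filter.
  have /all_pred1P <- := filter_all (pred1 a) s.
  by rewrite perm_sym perm_filterC.
have := reduce_duplicates N0 hN wa (c := N) (s := [::]) rs isT (leqnn _).
rewrite (_ : (_ + size rs)%N = size s); last first.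
  by rewrite (perm_size ps) /= size_cat size_nseq addn0.
by apply: in_ideal_ext => l; rewrite (gen_monomial_perm _ _ ps).
Qed.

Lemma monomials_absorbed : exists2 N, (0 < N)%N & forall d f, (N <= d)%N -> hom d f -> in_ideal d f.
Proof.
(* Every index sum is at most [n * j], so for this bound all generators are covered. *)
have [N N0 hN] := long_monomials_absorbed (n * j).+1.
exists N => // d f Nd [y hy].
apply: (@in_ideal_ext _ (fun l => \sum_(t : {ffun 'I_d -> A}) y t * mon (codom t) l)).
  by move=> l; rewrite hy; apply: eq_bigr => t _; rewrite gen_monomial_codom.
apply: in_ideal_sum => t _; apply: in_ideal_scale.
have := hN (codom t); rewrite size_codom card_ord; apply=> //.
apply/allP => a _; rewrite ltnS /index_sum.
rewrite -[X in (_ <= X * _)%N](card_ord n) -sum_nat_const.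
by apply: leq_sum => i _; apply: ltnW.
Qed.

(** A graded Nakayama argument: above degree [N] a factor [Z l k] can be split off, which lowers the
    degree of the cofactor by one, until only monomials of degree [N] remain. *)
Lemma finite_over_perm_tensor : exists N, forall m f, hom (N + m) f ->
  exists2 al : {ffun 'I_N -> A} -> Om -> C, (forall t, hform Z m (al t)) &
    forall l, f l = \sum_t al t l * \prod_s b l (t s).
Proof.
have [N N0 hN] := monomials_absorbed.
exists N; elim=> [|m IH] f hf.
  rewrite addn0 in hf; have [y hy] := hf.
  by exists (fun t _ => y t) => // t; apply: hform_const.
have [g hg e] := hN _ _ (leq_addr _ _) hf.
have /choice [al hal] k : exists al : {ffun 'I_N -> A} -> Om -> C, (forall t, hform Z m (al t)) /\
    forall l, g k l = \sum_t al t l * \prod_s b l (t s).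
  by have := hg k; rewrite addnS => /IH [al h1 h2]; exists al.
exists (fun t l => \sum_k Z l k * al k t l) => [t|l].
  apply: hform_sum => k _; rewrite -add1n; apply: hform_mul; first exact: hform_gen.
  by have [h _] := hal k.
rewrite e; under eq_bigr => k _.
  have [_ ->] := hal k; rewrite mulr_sumr; over.
rewrite exchange_big; apply: eq_bigr => t _; rewrite mulr_suml.
by apply: eq_bigr => k _; rewrite mulrA.
Qed.

(** The determinant trick, carried out pointwise: multiplication by [Q] maps the monomials of degree
    [N] to combinations of themselves with coefficients of degree [D] in [Z]. Thus [Q l] is an
    eigenvalue of [M l], and the equation is its characteristic polynomial. *)
Lemma integral_equation D Q : hom D Q -> exists r (c : nat -> Om -> C),
  (forall i, (i < r)%N -> hform Z ((r - i) * D) (c i)) /\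
  forall l, (forall i, exists x, l i x != 0) -> Q l ^+ r = \sum_(i < r) c i l * Q l ^+ i.
Proof.
move=> hQ; have [N hN] := finite_over_perm_tensor.
pose X := {ffun 'I_N -> A}; pose mo (t : X) l := \prod_s b l (t s).
have /choice [al hal] (t : X) : exists al : X -> Om -> C, (forall t', hform Z D (al t')) /\
    forall l, mo t l * Q l = \sum_t' al t' l * mo t' l.
  have [|al h1 h2] := hN D (fun l => mo t l * Q l); last by exists al.
  apply: hform_mul => //; have := hform_mono b (codom t); rewrite size_codom card_ord.
  by apply: hform_ext => l; rewrite -gen_monomial_codom.
pose M l : 'M[C]_#|{: X}| := \matrix_(i, k) al (enum_val k) (enum_val i) l.
exists #|{: X}|, (fun i l => - (char_poly (M l))`_i); split.
  move=> i ir; apply: (@hform_ext _ _ _ _ _ (fun l => -1 * (char_poly (M l))`_i)).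
    by move=> l; rewrite mulN1r.
  apply: hform_scale; apply: char_poly_hform (ltnW ir) => i' k'.
  by apply: (@hform_ext _ _ _ _ _ (al (enum_val k') (enum_val i'))) => [l|]; rewrite ?mxE //; have [] := hal (enum_val k').
move=> l hl.
have : eigenvalue (M l) (Q l).
  apply/eigenvalueP; exists (\row_i mo (enum_val i) l).
    apply/rowP => k; rewrite !mxE mulrC; have [_ ->] := hal (enum_val k).
    rewrite (reindex (@enum_val _ {: X})) /=; last exact/onW_bij/enum_val_bij.
    by apply: eq_bigr => i _; rewrite !mxE mulrC.
  (* A nonzero entry chosen in every row gives a monomial that does not vanish at [l], so the
     eigenvector is nonzero. *)
  have /choice [a ha] := hl.
  apply/eqP => /rowP /(_ (enum_rank [ffun=> [ffun i => a i]])); rewrite !mxE enum_rankK.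
  apply/eqP; apply/prodf_neq0 => s _; apply/prodf_neq0 => i _.
  by rewrite !ffunE.
rewrite eigenvalue_root_char => /rootP; rewrite horner_coef size_char_poly big_ord_recr /=.
have := char_poly_monic (M l); rewrite monicE lead_coefE size_char_poly /= => /eqP ->.
rewrite mul1r addrC => /eqP; rewrite addr_eq0 -sumrN => /eqP ->.
by apply: eq_bigr => i _; rewrite mulNr.
Qed.

End ProductsOfLinearForms.

(** * Semi-invariants of products of linear forms *)

Section CyclicBracket.
Variables (C : numFieldType) (n' j : nat).
Local Notation n := n'.+1.
Local Notation A := {ffun 'I_n -> 'I_j}.
Implicit Types (l : 'M[C]_(n, j)).

(* The row indices of a window are taken modulo n. *)
Definition window l (i : 'I_n) : 'M[C]_j := \matrix_(s, a) l (i + inord s) a.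

Definition bracket l : C := \prod_i \det (window l i).

(** For a fixed position [s] in the window, the index [i + inord s] runs once through all rows; each
    position therefore contributes one factor [entry_prod] to every term of the expansion. *)
Lemma bracket_hform : hform (@entry_prod C n j) j bracket.
Proof.
apply: (@hform_ext _ _ _ _ _ (fun l => \sum_(F : {ffun 'I_n -> 'S_j})
  (\prod_i (-1) ^+ F i) * \prod_(s <- enum 'I_j) entry_prod l [ffun i => F (i - inord s) s])).
  move=> l; rewrite /bracket /determinant bigA_distr_bigA; apply: eq_bigr => F _.
  rewrite big_split enumT /=; congr (_ * _).
  rewrite [RHS]exchange_big; apply: eq_bigr => s _ /=.
  have inj : injective (fun i : 'I_n => i + inord s) by move=> i i' /addIr.
  rewrite /entry_prod [LHS](reindex_inj inj) /=.
  by apply: eq_bigr => i _; rewrite ffunE mxE addrK.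
apply: hform_sum => F _; apply: hform_scale.
have := @hform_big_prod _ _ _ (@entry_prod C n j) _ (enum 'I_j)
  (fun s l => entry_prod l [ffun i => F (i - inord s) s]) (fun s => hform_gen _ _).
by rewrite size_enum_ord.
Qed.

Lemma bracket_mul l (g : 'M_j) : bracket (l *m g) = \det g ^+ n * bracket l.
Proof.
rewrite /bracket -[X in _ ^+ X]card_ord -prodr_const -big_split /=; apply: eq_bigr => i _.
rewrite mulrC -det_mulmx; congr (\det _); apply/matrixP => s a; rewrite !mxE.
by apply: eq_bigr => c _; rewrite !mxE.
Qed.

(** For rows on the moment curve every window is a transposed Vandermonde matrix, and [j <= n] makes
    its nodes distinct. *)
Lemma bracket_neq0 : (j <= n)%N -> exists l, bracket l != 0.
Proof.
move=> jn; exists (\matrix_(i, a) (i%:R ^+ a)).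
apply/prodf_neq0 => i _.
pose x : 'rV[C]_j := \row_s (nat_of_ord (i + inord s)%R)%:R.
have -> : window (\matrix_(i, a) (i%:R ^+ a)) i = (Vandermonde j x)^T.
  by apply/matrixP => s a; rewrite !mxE.
rewrite det_tr det_Vandermonde; apply/prodf_neq0 => s _; apply/prodf_neq0 => s' ss'.
rewrite !mxE subr_eq0 eqr_nat; apply: contraTneq ss' => /val_inj /addrI e.
have lt (k : 'I_j) : (k < n)%N by apply: leq_trans jn.
have := congr1 val e; rewrite /= !inordK // => ->.
by rewrite ltnn.
Qed.

(** Row [i] is the first row of window [i]. This supplies the hypothesis on [l] in
    [integral_equation]. *)
Lemma bracket_rows l : (0 < j)%N -> (j <= n)%N -> bracket l != 0 -> forall i, exists x, l i x != 0.
Proof.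
move=> j0 jn hl i; apply: contrapT => h; move/negP: hl; apply.
rewrite /bracket (bigD1 i) //= mulf_eq0; apply/orP; left.
have z x : l i x = 0 by apply/eqP; apply: contraT => hx; case: h; exists x.
apply/eqP; rewrite (expand_det_row _ (Ordinal j0)) big1 // => x _.
rewrite mxE (_ : i + inord _ = i) ?z ?mul0r //.
by apply/val_inj; rewrite /= inordK //= addn0 modn_small.
Qed.

End CyclicBracket.

Section Inclusion.
Variables (C : comNzRingType) (N : nat).

Definition inclusion j : 'M[C]_(N, j) := \matrix_(i, a) (i == a :> nat)%:R.

Lemma sum_inclusion j (jN : (j <= N)%N) (F : 'I_N -> C) (a : 'I_j) :
  \sum_i F i * inclusion j i a = F (widen_ord jN a).
Proof.
rewrite (bigD1 (widen_ord jN a)) //= mxE eqxx mulr1 big1 ?addr0 // => i ia.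
rewrite mxE; suff /negbTE -> : (i != a :> nat) by rewrite mulr0.
by apply: contra ia => /eqP e; apply/eqP/val_inj.
Qed.

Lemma inclusion_orthonormal j : (j <= N)%N -> (inclusion j)^T *m inclusion j = 1%:M.
Proof.
move=> jN; apply/matrixP => a c; rewrite mxE sum_inclusion !mxE /= val_eqE.
by rewrite eq_sym.
Qed.

(** An upper triangular matrix preserves the span of the first [j] basis vectors and acts there by
    its leading block [h]. *)
Lemma triangular_inclusion j (jN : (j <= N)%N) (g : 'M[C]_N) :
  (forall i k : 'I_N, (k < i)%N -> g i k = 0) ->
  exists2 h : 'M[C]_j, g *m inclusion j = inclusion j *m h &
    \det h = \prod_(a < j) g (widen_ord jN a) (widen_ord jN a).
Proof.
move=> hg; exists (\matrix_(a, c) g (widen_ord jN a) (widen_ord jN c)).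
  apply/matrixP => i c; rewrite mxE sum_inclusion mxE.
  have [ij|ji] := ltnP i j.
    rewrite (bigD1 (Ordinal ij)) //= !mxE eqxx mul1r big1 ?addr0.
      by congr (g _ _); apply/val_inj.
    move=> a ai; rewrite !mxE; suff /negbTE -> : (i != a :> nat) by rewrite mul0r.
    by apply: contra ai => /eqP e; apply/eqP/val_inj.
  rewrite hg /= ?(leq_trans (ltn_ord c)) // big1 // => a _.
  by rewrite [inclusion _ _ _]mxE gtn_eqF ?mul0r // (leq_trans (ltn_ord a)).
rewrite -det_tr det_trig; last by apply/is_trig_mxP => a c ac; rewrite !mxE hg.
by apply: eq_bigr => a _; rewrite !mxE.
Qed.

End Inclusion.

Section TensorsOfForms.
Variables (C : numClosedFieldType) (n j : nat) (I : finType).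
Local Notation T := {ffun {ffun I -> {ffun 'I_n -> 'I_j}} -> C^o}.
Implicit Types (l : 'M[C]_(n, j)).

(** Pairings with [pure_tensor] give the functions homogeneous in the monomials [entry_prod];
    pairings with [form_tensor] give those homogeneous in the coefficients [perm_tensor]. *)
Definition pure_tensor l : T := [ffun t : {ffun I -> {ffun 'I_n -> 'I_j}} => \prod_s entry_prod l (t s)].
Definition form_tensor l : T := [ffun t : {ffun I -> {ffun 'I_n -> 'I_j}} => \prod_s perm_tensor l (t s)].

End TensorsOfForms.

Section TensorsOfFormsAction.
Variables (C : numClosedFieldType) (n : nat) (I : finType).

Lemma tfun_pure_tensor j j' (g : 'M[C]_(j', j)) (l : 'M_(n, j)) :
  tfun g (pure_tensor I l) = pure_tensor I (l *m g^T).
Proof.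
apply/ffunP => t; rewrite !ffunE; under [LHS]eq_bigr do rewrite ffunE.
refine (eq_trans (kernel_power_apply (kernel_power (fun a b => g a b)) (fun=> entry_prod l) t) _).
apply: eq_bigr => s _; rewrite (kernel_power_apply _ (fun i x => l i x)); apply: eq_bigr => i _.
by rewrite mxE; apply: eq_bigr => x _; rewrite mxE mulrC.
Qed.

Lemma tfun_form_tensor j j' (g : 'M[C]_(j', j)) (l : 'M_(n, j)) :
  tfun g (form_tensor I l) = form_tensor I (l *m g^T).
Proof.
apply/ffunP => t; rewrite !ffunE; under [LHS]eq_bigr do rewrite ffunE.
refine (eq_trans (kernel_power_apply (kernel_power (fun a b => g a b)) (fun=> perm_tensor l) t) _).
apply: eq_bigr => s _; rewrite /perm_tensor; under eq_bigr do rewrite mulr_sumr.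
rewrite exchange_big; apply: eq_bigr => p _.
rewrite (kernel_power_apply _ (fun i x => l (p i) x)); apply: eq_bigr => i _.
by rewrite mxE; apply: eq_bigr => x _; rewrite mxE mulrC.
Qed.

End TensorsOfFormsAction.

(** * From semi-invariants of the linear forms to semi-invariants of their product *)

Section SemiInvariant.
Variables (C : numClosedFieldType) (n' j : nat).
Local Notation n := n'.+1.
Hypotheses (j0 : (0 < j)%N) (jn : (j <= n)%N).
Local Notation Q := (@bracket C n' j).
Local Notation eps d := (@pure_tensor C n j 'I_d).
Local Notation T d := {ffun {ffun 'I_d -> {ffun 'I_n -> 'I_j}} -> C^o}.

Lemma hform_functional d f : hform (@entry_prod C n j) d f ->
  exists y : T d, forall l, f l = dot (eps d l) y.
Proof.
move=> [y hy]; exists [ffun t => Num.conj (y t)] => l.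
by rewrite hy; apply: eq_bigr => t _; rewrite !ffunE conjCK mulrC.
Qed.

(* The tensor representing Q^r, projected to the span of the pure tensors at which Q does
   not vanish, inherits semi-invariance from Q and is still represents Q^r there. *)
Lemma semi_invariant_tensor r : exists q : T (r * j), exists2 s : seq (C * 'M[C]_(n, j)),
  [/\ q = \sum_(x <- s) x.1 *: eps _ x.2, forall x, x \in s -> Q x.2 != 0 &
   forall g : 'M_j, g \in unitmx -> tfun g q = \det g ^+ (r * n) *: q] & \sum_(x <- s) x.1 * Q x.2 ^+ r != 0.
Proof.
have [y hy] := hform_functional (hform_exp r (bracket_hform C n' j)).
have [bs hbs hbsP] := span_predicate (fun u => exists2 l, Q l != 0 & u = eps (r * j) l).
have [q qL hq] := orth_decomposition <<bs>>%VS y.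
have dotq l : Q l != 0 -> dot (eps _ l) q = Q l ^+ r.
  move=> Ql; rewrite hy -[X in _ = dot _ X](subrK q) dotDr.
  by rewrite [X in _ = X + _]dotC hq ?conjC0 ?add0r //; apply: hbsP; exists l.
have /choice [f hf] (i : 'I_(size bs)) : exists l, Q l != 0 /\ bs`_i = eps (r * j) l.
  by have /hbs [l h1 h2] : bs`_i \in bs; [rewrite mem_nth | exists l].
have spanE u : u \in <<bs>>%VS -> u = \sum_i coord (in_tuple bs) i u *: eps (r * j) (f i).
  by move=> /(coord_span (X := in_tuple bs)) {1}->; apply: eq_bigr => i _; have [_ <-] := hf i.
exists q, [seq (coord (in_tuple bs) i q, f i) | i <- enum 'I_(size bs)]; last first.
  (* The sum over [s] equals [dot q q], and [q] is nonzero because it still represents the nonzero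
     function Q^r. *)
  have : dot q q != 0.
    rewrite dot_eq0; have [l Ql] := bracket_neq0 C jn.
    apply: contraNneq (expf_neq0 r Ql) => q0.
    by rewrite -dotq // q0 dot0r.
  rewrite {1}(spanE q qL) dot_suml big_map enumT; congr (_ != 0).
  by apply: eq_bigr => i _; rewrite dotZl dotq //; have [] := hf i.
split; first by rewrite big_map enumT; exact: spanE.
  by move=> _ /mapP [i _ ->] /=; have [] := hf i.
move=> g gu; have dg : \det g != 0 by rewrite -unitfE -unitmxE.
have wL : tfun g q - \det g ^+ (r * n) *: q \in <<bs>>%VS.
  apply: rpredB; last exact: rpredZ.
  rewrite (spanE q qL) linear_sum; apply: rpred_sum => i _; rewrite linearZ; apply: rpredZ.
  rewrite /= tfun_pure_tensor; apply: hbsP; exists (f i *m g^T) => //.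
  by rewrite bracket_mul det_tr mulf_neq0 ?expf_neq0 //; have [] := hf i.
(* Moved to the other side, [g] becomes its adjoint and changes [Q] by a power of the conjugate of
   [\det g]; the scalar in the second argument of [dot] is conjugated as well, so the two terms
   cancel. *)
have orth l : Q l != 0 -> dot (eps _ l) (tfun g q - \det g ^+ (r * n) *: q) = 0.
  move=> Ql; rewrite dotBr dotZr dotq // -{1}[g]adjmxK -tfun_adj tfun_pure_tensor dotq; last first.
    by rewrite bracket_mul det_tr det_adjmx mulf_neq0 ?expf_neq0 ?conjC_eq0.
  by rewrite bracket_mul det_tr det_adjmx exprMn -exprM mulnC rmorphXn subrr.
apply/eqP; rewrite -subr_eq0 -dot_eq0; apply/eqP.
rewrite {1}(spanE _ wL) dot_suml big1 // => i _; have [Qi _] := hf i.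
by rewrite dotZl orth ?mulr0.
Qed.

(** The functional given by [s] is applied to the integral equation of [Q]. It sends Q^r to a
    nonzero number and the term with coefficient [c i] to a linear combination of the coordinates of
    [V i], so some [V i] is nonzero. Each [V i] inherits semi-invariance from [q]. *)
Lemma semi_invariant_of_forms : exists2 m, (0 < m)%N & exists V : T (m * j),
  (forall g : 'M_j, g \in unitmx -> tfun g V = \det g ^+ (m * n) *: V) /\
  exists l, dot (form_tensor _ l) V != 0.
Proof.
have [r [c [hc eqQ]]] := integral_equation (bracket_hform C n' j).
have [q [s [qE sQ qinv] nz]] := semi_invariant_tensor r.
pose V i : T ((r - i) * j) := \sum_(x <- s) (x.1 * Q x.2 ^+ i) *: form_tensor _ x.2.
have Vinv i (g : 'M_j) : (i < r)%N -> g \in unitmx -> tfun g (V i) = \det g ^+ ((r - i) * n) *: V i.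
  move=> ir gu; have dg : \det g != 0 by rewrite -unitfE -unitmxE.
  (* Compare after multiplication by the factor with which Q^i changes; the exponents then add up to
     [r * n], the one known for [q]. *)
  apply: (scalerI (expf_neq0 (i * n) dg)); rewrite scalerA -exprD -mulnDl subnKC ?(ltnW ir) //.
  apply/ffunP => t.
  have [|y hy] := @hform_functional (r * j) (fun l => Q l ^+ i * form_tensor 'I_((r - i) * j) l t).
    have -> : (r * j = i * j + (r - i) * j)%N by rewrite -mulnDl subnKC // ltnW.
    apply: hform_mul; first exact: hform_exp (bracket_hform C n' j).
    apply: (@hform_ext _ _ _ _ _ (gen_monomial (@perm_tensor C n j) (codom t))) => [l|].
      by rewrite ffunE gen_monomial_codom.
    apply: (hform_comp (@hform_perm_tensor C n j)).
    by have := hform_mono (@perm_tensor C n j) (codom t); rewrite size_codom card_ord.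
  have Vt : (V i) t = \sum_(x <- s) x.1 * dot (eps _ x.2) y.
    by rewrite sum_ffunE; apply: eq_bigr => x _; rewrite -hy ffunE mulrA.
  transitivity (dot (tfun g q) y).
    rewrite ffunE qE /V !linear_sum dot_suml sum_ffunE.
    rewrite [LHS]mulr_sumr; apply: eq_bigr => x _.
    rewrite !linearZ dotZl /= tfun_pure_tensor -hy bracket_mul det_tr tfun_form_tensor.
    rewrite exprMn -exprM [(n * i)%N]mulnC ffunE.
    rewrite [X in _ * X](_ : _ = x.1 * Q x.2 ^+ i * form_tensor _ (x.2 *m g^T) t) //.
    by rewrite -!mulrA mulrCA.
  rewrite qinv // dotZl qE dot_suml ffunE [RHS]/(_ * _); congr (_ * _).
  by rewrite Vt; apply: eq_bigr => x _; rewrite dotZl.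
have /existsP [i Vi] : [exists i : 'I_r, V i != 0].
  apply: contraT; rewrite negb_exists => /forallP h; move: nz.
  rewrite big_seq (eq_bigr (fun x => \sum_(i < r) x.1 * (c i x.2 * Q x.2 ^+ i))) => [|x xs]; last first.
    by rewrite eqQ ?mulr_sumr //; apply: bracket_rows => //; apply: sQ.
  rewrite -big_seq exchange_big big1 ?eqxx //= => i _.
  have [y hy] := hc i (ltn_ord i).
  transitivity (\sum_t y t * V i t).
    transitivity (\sum_(x <- s) \sum_t y t * (x.1 * Q x.2 ^+ i * form_tensor 'I_((r - i) * j) x.2 t)).
      apply: eq_bigr => x _; rewrite hy mulr_suml mulr_sumr.
      by apply: eq_bigr => t _; rewrite ffunE; ring.
    rewrite exchange_big; apply: eq_bigr => t _; rewrite sum_ffunE -mulr_sumr; congr (_ * _).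
    by apply: eq_bigr => x _; rewrite !ffunE.
  by rewrite big1 // => t _; have := h i; rewrite negbK => /eqP ->; rewrite ffunE mulr0.
exists (r - i)%N; first by rewrite subn_gt0.
exists (V i); split=> [g gu|]; first exact: Vinv.
(* Since [V i] is a combination of form tensors, pairing to zero with all of them would make it
   orthogonal to itself. *)
apply: contrapT => h; move: Vi; rewrite -dot_eq0 {1}/V dot_suml big1 ?eqxx // => x _.
rewrite dotZl; apply/eqP; rewrite mulf_eq0; apply/orP; right.
by apply: contraT => hx; case: h; exists x.2.
Qed.

End SemiInvariant.

(** * Weights occurring for the determinant *)

Section DeterminantCriterion.
Variables (R : realType) (n : nat) (I : finType).
Local Notation C := R[i].
Local Notation N := (n * n)%N.
Local Notation T := {ffun {ffun I -> {ffun 'I_n -> 'I_N}} -> C^o}.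

Definition linear_forms (m : 'I_n -> 'I_n -> 'I_N -> C) : 'M[{mpoly C[N]}]_n :=
  \matrix_(i, k) \sum_x m i k x *: 'X_x.

(** A matrix of linear forms arises from the generic matrix by a linear substitution, whose matrix
    may be singular. *)
Lemma det_linear_forms m : exists g : 'M[C]_N,
  mpoly_of_dhomog (form_act g (det_form R n)) = \det (linear_forms m).
Proof.
exists (\matrix_(x, y) mxvec (\matrix_(i, k) m i k x) 0 y).
rewrite /= -det_map_mx; congr (\det _); apply/matrixP => i k; rewrite !mxE /=.
rewrite comp_mpolyXU -tnth_nth tnth_mktuple; apply: eq_bigr => x _.
by rewrite !mxE mxvecE mxE.
Qed.

(** Semi-invariance under invertible upper triangular matrices covers the unipotent part and the
    torus at once. *)
Lemma det_weights_criterion (e : 'I_N -> nat) (v : T) m :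
  (forall i k : 'I_N, (i <= k)%N -> (e k <= e i)%N) ->
  (forall g : 'M[C]_N, (forall i k : 'I_N, (k < i)%N -> g i k = 0) -> (forall i, g i i != 0) ->
    tfun g v = (\prod_i g i i ^+ e i) *: v) ->
  dot [ffun t : {ffun I -> {ffun 'I_n -> 'I_N}} => \prod_b symT (\det (linear_forms m)) (t b)] v != 0 ->
  highest_weights (Det R n) (\row_i (e i)%:Z).
Proof.
move=> he hv nz; have [g hg] := det_linear_forms m.
apply: (@highest_weights_criterion R N n I (Det R n) (det_form R n) _ v _ _ _ _ g).
- exact: sub_gen_smallest.
- by move=> i k ik; rewrite !mxE lez_nat he.
- move=> u hu; rewrite trepE hv; last 2 first.
  + by move=> i k ki; rewrite hu ?(ltnW ki) // -val_eqE gtn_eqF.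
  + by move=> i; rewrite hu // eqxx oner_neq0.
  by rewrite big1 ?scale1r // => i _; rewrite hu // eqxx expr1n.
- move=> t ht; rewrite trepE hv; last 2 first.
  + by move=> i k ki; rewrite mxE -val_eqE gtn_eqF // mulr0n.
  + by move=> i; rewrite mxE eqxx mulr1n.
  by congr (_ *: _); apply: eq_bigr => i _; rewrite !mxE eqxx mulr1n.
- by rewrite /power_tensor hg.
Qed.

End DeterminantCriterion.

Section Rays.
Variables (R : realType) (n' : nat).
Local Notation n := n'.+1.
Local Notation C := R[i].
Local Notation N := (n * n)%N.

(** The [GL_j]-semi-invariant, carried to [N] variables by [inclusion], becomes a highest weight
    vector. It is tested on a diagonal matrix of linear forms, whose determinant is their
    product. *)
Lemma rectangular_weight j : (0 < j)%N -> (j <= n)%N -> exists2 k, (0 < k)%N &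
  highest_weights (Det R n) (\row_i (if (i < j)%N then k else 0)%:Z).
Proof.
move=> j0 jn; have jN : (j <= N)%N by apply: leq_trans jn _; rewrite leq_pmulr.
have [m m0 [V [hV [l nz]]]] := semi_invariant_of_forms C j0 jn.
exists (m * n)%N; first by rewrite muln_gt0 m0.
pose l' := l *m (inclusion C N j)^T.
apply: (@det_weights_criterion R n _ _ (tfun (inclusion C N j) V)
  (fun i k x => if i == k then l' i x else 0)).
- move=> i k ik; case: ifP => // kj; by rewrite (leq_ltn_trans ik kj).
- move=> g hg gd; have [h e dh] := triangular_inclusion jN hg.
  rewrite -tfunM e tfunM hV; last first.
    by rewrite unitmxE unitfE dh; apply/prodf_neq0 => a _.
  rewrite linearZ /= dh -prodrXl; congr (_ *: _).
  rewrite (bigID (fun i : 'I_N => i < j)%N) /= [X in _ * X]big1 => [|i /negbTE ->]; last by rewrite expr0.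
  rewrite mulr1 (eq_bigr (fun i => g i i ^+ (m * n))) => [|i ->] //.
  by rewrite (big_ord_narrow jN).
rewrite (_ : \det _ = \prod_i \sum_x l' i x *: 'X_x); last first.
  rewrite det_trig; last first.
    apply/is_trig_mxP => i k ik; rewrite mxE big1 // => x _.
    by rewrite -val_eqE ltn_eqF // scale0r.
  by apply: eq_bigr => i _; rewrite mxE; apply: eq_bigr => x _; rewrite eqxx.
have -> : [ffun t : {ffun 'I_(m * j) -> {ffun 'I_n -> 'I_N}} =>
    \prod_b symT (\prod_i \sum_x l' i x *: 'X_x) (t b)] =
    (n`!%:R^-1) ^+ (m * j) *: form_tensor _ l' :> {ffun _ -> C^o}.
  apply/ffunP => t; rewrite !ffunE -[X in _ ^+ X]card_ord -prodr_const.
  refine (eq_trans _ (big_split _ _ _ _ _)).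
  by apply: eq_bigr => b _; rewrite (symT_prod (fun i x => l' i x)).
rewrite dotZl mulf_neq0 ?expf_neq0 ?invr_eq0 ?pnatr_eq0 -?lt0n ?fact_gt0 //.
rewrite -[inclusion C N j]adjmxK -tfun_adj tfun_form_tensor.
suff -> : l' *m (adjmx (inclusion C N j))^T = l by [].
rewrite /l' -mulmxA (_ : _^T *m _ = 1%:M) ?mulmx1 // -(inclusion_orthonormal C jN); congr (_ *m _).
by apply/matrixP => i a; rewrite !mxE /= conjC_nat.
Qed.

End Rays.

(** * Hessenberg determinants *)

Section Hessenberg.
Variable (D : idomainType).

(** The vector with entries x^(n-i) y^i is annihilated by all rows except the first. Putting it into
    the first column of [W] makes [A *m W] block triangular with corner [z], and the factor x^n
    common to both sides cancels. *)
Lemma det_hessenberg n (x y : D) (c : 'I_n.+1 -> D) : x != 0 ->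
  \det (\matrix_(i < n.+1, k < n.+1) (if i == 0 :> nat then c k else
     (if k == i :> nat then x else 0) - (if k.+1 == i :> nat then y else 0)))
  = \sum_(k < n.+1) x ^+ (n - k) * y ^+ k * c k.
Proof.
move=> x0; set A := \matrix_(i, k) _; set z := \sum_k _.
pose w (i : nat) := x ^+ (n - i) * y ^+ i.
pose W : 'M[D]_n.+1 := \matrix_(i, k) (if k == 0 :> nat then w i else (i == k)%:R).
pose B : 'M[D]_(1 + n) := block_mx z%:M (\row_k A ord0 (lift ord0 k)) 0
  (\matrix_(i, k) A (lift ord0 i) (lift ord0 k)).
have AW : A *m W = B :> 'M_(1 + n).
  apply/matrixP => i k; rewrite mxE.
  case: (split_ordP (k : 'I_(1 + n))) => k' ->.
    rewrite [k']ord1 (eq_bigr (fun q : 'I_n.+1 => A i q * w q)) => [|q _]; last by rewrite [W _ _]mxE.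
    case: (split_ordP (i : 'I_(1 + n))) => i' ->.
      rewrite [i']ord1 /B block_mxEul mxE eqxx mulr1n; apply: eq_bigr => q _.
      by rewrite mxE /= mulrC.
    rewrite /B block_mxEdl mxE.
    have lt : (i' < n.+1)%N by apply: ltnW; rewrite ltnS.
    rewrite (bigD1 (rshift 1 i')) //= (bigD1 (Ordinal lt)) /=; last first.
      by rewrite -val_eqE /= ltn_eqF.
    rewrite big1 ?addr0 => [|q /andP [h1 h2]].
      rewrite !mxE /= !add1n !eqxx !eqSS (gtn_eqF (ltnSn i')) (ltn_eqF (ltnSn i')) /w.
      have -> : (n - i' = (n - i'.+1).+1)%N by have := ltn_ord i'; lia.
      rewrite !exprS; ring.
    rewrite !mxE /= !add1n; move: h1 h2; rewrite -!val_eqE /= [(1 + i')%N]add1n => /negbTE -> /negbTE h2.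
    by rewrite eqSS h2 subrr mul0r.
  rewrite (bigD1 (rshift 1 k')) //= big1 ?addr0.
    rewrite [W _ _]mxE /= eqxx mulr1.
    case: (split_ordP (i : 'I_(1 + n))) => i' ->.
      rewrite [i']ord1 /B block_mxEur [RHS]mxE; congr (A _ _); exact: val_inj.
    rewrite /B block_mxEdr [RHS]mxE; congr (A _ _); exact: val_inj.
  by move=> q /negbTE qk; rewrite [W _ _]mxE /= qk mulr0.
have dW : \det W = x ^+ n.
  rewrite det_trig.
    rewrite big_ord_recl big1 => [|q _]; last by rewrite mxE /= eqxx.
    by rewrite mxE /= mulr1 /w subn0 expr0 mulr1.
  apply/is_trig_mxP => i k ik; rewrite mxE; case: eqP => [k0|_].
    by move: ik; rewrite k0.
  by rewrite -val_eqE ltn_eqF.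
have dB : \det B = z * x ^+ n.
  rewrite det_ublock det_scalar1 det_trig.
    rewrite -[X in _ ^+ X](card_ord n) -prodr_const; congr (_ * _); apply: eq_bigr => q _.
    by rewrite !mxE /= eqxx /bump /= gtn_eqF ?subr0.
  apply/is_trig_mxP => i k ik; rewrite !mxE /= /bump /= !add1n !eqSS.
  by rewrite gtn_eqF // gtn_eqF ?subrr // ltnW.
have := det_mulmx A W; rewrite AW dB dW => /mulIf e.
by apply/esym/e; rewrite expf_neq0.
Qed.

End Hessenberg.

(** * Bracket tensors *)

Lemma triangular_bracket (C : comNzRingType) (a b c p p' q q' : C) :
  a * p * (b * q' + c * q) - (b * p' + c * p) * (a * q) = a * b * (p * q' - p' * q).
Proof. ring. Qed.

Section BracketTensor.
Variables (C : numClosedFieldType) (n' N j : nat).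
Local Notation n := n'.+1.
Hypotheses (j2 : (1 < j)%N) (jN : (j <= N)%N).
Variable mu : 'I_j -> nat.

Local Notation I := ('I_j + 'I_j * 'I_n)%type.
Local Notation idx := {ffun I -> {ffun 'I_n -> 'I_N}}.
Local Notation T := {ffun idx -> C^o}.
Local Notation w := (widen_ord jN).

Definition first_var : 'I_N := w (Ordinal (ltnW j2)).
Definition second_var : 'I_N := w (Ordinal j2).
Local Notation x0 := first_var.
Local Notation x1 := second_var.

(* The tensor is built on main blocks [inl b], each containing slots [k < n], and reference blocks
   [inr (b, k)].  The slots 0 of the main blocks are joined by a j x j determinant; if (b, k) is
   linked, slot k of the main block b and slot 0 of the reference block (b, k) are joined by a
   2 x 2 determinant, whose two terms are selected by [chi]; every other slot carries the first
   variable. *)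
Definition linked (p : 'I_j * 'I_n) : bool := (0 < p.2 <= mu p.1)%N.

Definition bracket_index (s : 'S_j) (chi : {ffun 'I_j * 'I_n -> bool}) : idx :=
  [ffun u => [ffun k => match u with
    | inl b => if k == ord0 then w (s b) else if linked (b, k) && chi (b, k) then x1 else x0
    | inr p => if [&& k == ord0, linked p & ~~ chi p] then x1 else x0 end]].

(** A pair that is not linked gets coefficient 0 for [chi p = true], so that all pairs can be summed
    over both values of [chi]. *)
Definition bracket_coef (s : 'S_j) (chi : {ffun 'I_j * 'I_n -> bool}) : C :=
  (-1) ^+ s * \prod_p (if linked p then (if chi p then -1 else 1) else (if chi p then 0 else 1)).

Definition bracket_tensor : T :=
  [ffun t : idx => \sum_s \sum_chi bracket_coef s chi * (bracket_index s chi == t)%:R].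

(** The contraction of the tensor with a product of vectors, in factored form. Slot 0 of a main
    block is left out of the product over pairs because the determinant uses it. *)
Definition bracket_form (x : I -> 'I_n -> 'I_N -> C) : C :=
  \det (\matrix_(b < j, a < j) x (inl b) ord0 (w a)) *
  \prod_p (
    (if linked p then x (inl p.1) p.2 x0 * x (inr p) ord0 x1 - x (inl p.1) p.2 x1 * x (inr p) ord0 x0
     else (if p.2 == ord0 then 1 else x (inl p.1) p.2 x0) * x (inr p) ord0 x0) *
    \prod_(k : 'I_n | k != ord0) x (inr p) k x0).

Lemma bracket_formE x :
  bracket_form x = \sum_s \sum_chi bracket_coef s chi * \prod_u \prod_k x u k (bracket_index s chi u k).
Proof.
rewrite /bracket_form /determinant mulr_suml; apply: eq_bigr => s _.
pose F (p : 'I_j * 'I_n) (c : bool) : C :=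
  (if linked p then (if c then -1 else 1) else (if c then 0 else 1)) *
  ((if p.2 == ord0 then 1 else x (inl p.1) p.2 (if linked p && c then x1 else x0)) *
   (x (inr p) ord0 (if linked p && ~~ c then x1 else x0) * \prod_(k : 'I_n | k != ord0) x (inr p) k x0)).
rewrite [X in _ * X](eq_bigr (fun p => \sum_c F p c)) => [|p _]; last first.
  rewrite big_bool /F; case lp : (linked p) => /=.
    have -> : (p.2 == ord0) = false by move: lp; rewrite /linked -val_eqE /= lt0n => /andP [/negbTE].
    ring.
  by case: ifP => _; ring.
rewrite bigA_distr_bigA mulr_sumr; apply: eq_bigr => chi _.
rewrite /bracket_coef -!mulrA; congr (_ * _).
under [X in X * _ = _]eq_bigr do rewrite mxE.
rewrite /F big_split /= mulrCA; congr (_ * _).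
rewrite big_sumType /=.
rewrite [X in _ = X * _](eq_bigr (fun b => x (inl b) ord0 (w (s b)) *
    \prod_(k < n) (if k == ord0 then 1 else x (inl b) k (if linked (b, k) && chi (b, k) then x1 else x0)))); last first.
  move=> b _; rewrite (bigD1 ord0) //= !ffunE /=; congr (_ * _).
  rewrite [RHS](bigD1 ord0) //= mul1r; apply: eq_bigr => k /negbTE k0.
  by rewrite !ffunE k0.
rewrite [X in _ = X * _]big_split /= -mulrA; congr (_ * _).
rewrite pair_big /= big_split /=; congr (_ * _).
  by apply: eq_bigr; case.
apply: eq_bigr => p _; rewrite [RHS](bigD1 ord0) //= !ffunE /=; congr (_ * _).
by apply: eq_bigr => k /negbTE k0; rewrite !ffunE k0.
Qed.

Lemma dot_bracket_tensor (F : T) :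
  dot F bracket_tensor = \sum_s \sum_(chi : {ffun 'I_j * 'I_n -> bool}) Num.conj (bracket_coef s chi) * F (bracket_index s chi).
Proof.
rewrite /dot; under eq_bigr => t _.
  rewrite ffunE rmorph_sum mulr_sumr.
  under eq_bigr do rewrite rmorph_sum mulr_sumr.
  over.
rewrite exchange_big; apply: eq_bigr => s _; rewrite exchange_big; apply: eq_bigr => chi _.
rewrite (bigD1 (bracket_index s chi)) //= big1 => [|t /negbTE ht].
  by rewrite addr0 eqxx mulr1 mulrC.
by rewrite eq_sym ht mulr0 conjC0 mulr0.
Qed.

Lemma tfun_bracket_tensor (g : 'M[C]_N) (t : idx) :
  tfun g bracket_tensor t = bracket_form (fun u k i => g (t u k) i).
Proof.
rewrite ffunE bracket_formE; under eq_bigr => t' _.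
  rewrite ffunE mulr_sumr.
  under eq_bigr do rewrite mulr_sumr.
  over.
rewrite exchange_big; apply: eq_bigr => s _; rewrite exchange_big; apply: eq_bigr => chi _.
rewrite (bigD1 (bracket_index s chi)) //= big1 => [|t' /negbTE ht].
  by rewrite addr0 eqxx mulr1 mulrC.
by rewrite eq_sym ht !mulr0.
Qed.

(** The sum of the weights of the factors of [bracket_form]: (1^j) for the determinant, (1,1) for a
    linked pair and (1) for every other slot. *)
Definition bracket_weight (i : 'I_N) : nat :=
  ((i < j) + \sum_(p : 'I_j * 'I_n)
    ((if linked p then (i < 2)%N : nat else (if p.2 == ord0 then 0 else (i < 1)%N) + (i < 1)%N)
     + \sum_(k : 'I_n | k != ord0) (i < 1)%N))%N.

Lemma diag_prod_initial (g : 'M[C]_N) h (hN : (h <= N)%N) :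
  \prod_i g i i ^+ (i < h)%N = \prod_(a < h) g (widen_ord hN a) (widen_ord hN a).
Proof.
rewrite (bigID (fun i : 'I_N => i < h)%N) /= [X in _ * X]big1 => [|i /negbTE ->]; last by rewrite expr0.
rewrite mulr1 (eq_bigr (fun i => g i i)) => [|i ->]; last by rewrite expr1.
by rewrite (big_ord_narrow hN).
Qed.

(** Each factor of [bracket_form] is a minor in the first 1, 2 or [j] columns, so an upper
    triangular [g] multiplies it by the leading principal minor of that size. *)
Lemma bracket_tensor_weight (g : 'M[C]_N) : (forall i k : 'I_N, (k < i)%N -> g i k = 0) ->
  tfun g bracket_tensor = (\prod_i g i i ^+ bracket_weight i) *: bracket_tensor.
Proof.
move=> hg; apply/ffunP => t; rewrite [RHS]ffunE -{2}[bracket_tensor]tfun1 !tfun_bracket_tensor.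
have g0 c : g c x0 = g x0 x0 * (1%:M : 'M_N) c x0.
  rewrite mxE; have [->|cx] := eqVneq c x0; first by rewrite mulr1.
  rewrite hg ?mulr0 // lt0n; by move: cx; rewrite -val_eqE.
have g1 c : g c x1 = g x1 x1 * (1%:M : 'M_N) c x1 + g x0 x1 * (1%:M : 'M_N) c x0.
  rewrite !mxE; have [->|cx1] := eqVneq c x1.
    by rewrite mulr1 (_ : x1 == x0 = false) ?mulr0 ?addr0 // -val_eqE.
  have [->|cx0] := eqVneq c x0; first by rewrite mulr0 mulr1 add0r.
  rewrite hg ?mulr0 ?addr0 //; move: cx0 cx1; rewrite -!val_eqE /=; case: (val c) => [|[|]] //.
have N0 : (0 < N)%N by apply: leq_trans jN; apply: ltnW.
have N1 : (1 < N)%N by apply: leq_trans jN.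
have e0 : \prod_i g i i ^+ (i < 1)%N = g x0 x0.
  by rewrite (diag_prod_initial g N0) big_ord1; congr (g _ _); apply: val_inj.
have e1 : \prod_i g i i ^+ (i < 2)%N = g x0 x0 * g x1 x1.
  by rewrite (diag_prod_initial g N1) big_ord_recl big_ord1; congr (g _ _ * g _ _); apply: val_inj.
rewrite /bracket_weight; under [X in _ = X *: _]eq_bigr do rewrite exprD -prodrXr.
have scE (a b : C) : a *: (b : C^o) = a * b by [].
rewrite big_split /= (diag_prod_initial g jN) exchange_big /= scE.
rewrite /bracket_form mulrACA; congr (_ * _).
  have [h e dh] := triangular_inclusion jN hg.
  pose S : 'M[C]_(j, N) := \matrix_(b, i) (1%:M : 'M_N) (t (inl b) ord0) i.
  have Sg (f : 'M_N) : \matrix_(b, a) f (t (inl b) ord0) (w a) = S *m f *m inclusion C N j.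
    apply/matrixP => b a; rewrite !mxE (sum_inclusion jN) mxE (bigD1 (t (inl b) ord0)) //= !mxE eqxx mul1r.
    by rewrite big1 ?addr0 // => i /negbTE ib; rewrite !mxE eq_sym ib mul0r.
  by rewrite !Sg mulmx1 -mulmxA e mulmxA det_mulmx dh mulrC.
rewrite -big_split; apply: eq_bigr => p _.
under [X in _ = X * _]eq_bigr do rewrite exprD -prodrXr.
rewrite big_split /= exchange_big /= mulrACA; congr (_ * _).
  case: ifP => lp.
    rewrite e1 (g0 (t (inl _) _)) (g0 (t (inr _) _)) (g1 (t (inl _) _)) (g1 (t (inr _) _)).
    exact: triangular_bracket.
  under [X in _ = X * _]eq_bigr do rewrite exprD.
  rewrite big_split /= e0 (g0 (t (inr _) _)); case: eqP => _.
    by rewrite big1 ?mul1r // => i _; rewrite expr0.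
  by rewrite e0 (g0 (t (inl _) _)) mulrACA.
rewrite -big_split; apply: eq_bigr => k _.
by rewrite e0 [LHS]g0.
Qed.

End BracketTensor.

Lemma sum_threshold (p q a b : nat) : (p <= q)%N ->
  (\sum_(k < q) (if k < p then a else b) = p * a + (q - p) * b)%N.
Proof.
move=> pq; rewrite -(big_mkord xpredT (fun k => if (k < p)%N then a else b)).
rewrite (@big_cat_nat _ _ _ p) //= big_nat (eq_bigr (fun=> a)) => [|k /andP [_ ->]] //.
rewrite [X in (_ + X)%N]big_nat [X in (_ + X)%N](eq_bigr (fun=> b)) => [|k /andP [pk _]]; last by rewrite ltnNge pk.
by rewrite -!big_nat !sum_nat_const_nat subn0.
Qed.

(** * Nonvanishing of bracket tensors on Hessenberg determinants *)

Section BracketWeight.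
Variables (R : realType) (n' j : nat).
Local Notation n := n'.+1.
Local Notation N := (n * n)%N.
Local Notation C := R[i].
Hypotheses (j2 : (1 < j)%N) (jN : (j <= N)%N).
Variable mu : 'I_j -> nat.
Local Notation b0 := (Ordinal (ltnW j2)).
Local Notation b1 := (Ordinal j2).
Hypotheses (mu_inj : injective mu) (mu0 : mu b0 = 0%N) (mun : forall b, (mu b < n)%N).
Local Notation w := (widen_ord jN).
Local Notation x0 := (first_var j2 jN).
Local Notation x1 := (second_var j2 jN).

Definition index_monomial (b a : 'I_j) : 'X_{1..N} := (U_(w a) + U_(x1) *+ mu b + U_(x0) *+ (n' - mu b))%MM.

Definition hess_form (i k : 'I_n) (x : 'I_N) : C :=
  if i == 0 :> nat then \sum_(b | inord (mu b) == k) (w b == x)%:R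
  else (if k == i :> nat then (x == x0)%:R else 0) - (if k.+1 == i :> nat then (x == x1)%:R else 0).

Lemma det_hess_form : \det (linear_forms hess_form) = \sum_b 'X_[index_monomial b b].
Proof.
have sumX (x : 'I_N) : \sum_y (y == x)%:R *: 'X_y = 'X_x :> {mpoly C[N]}.
  by rewrite (bigD1 x) //= eqxx scale1r big1 ?addr0 // => y /negbTE ->; rewrite scale0r.
pose c (k : 'I_n) : {mpoly C[N]} := \sum_(b | inord (mu b) == k) 'X_(w b).
transitivity (\sum_(k < n'.+1) 'X_x0 ^+ (n' - k) * 'X_x1 ^+ k * c k).
  rewrite -det_hessenberg; last by rewrite -msupp_eq0 msuppX.
  congr (\det _); apply/matrixP => i k; rewrite !mxE /hess_form.
  case: ifP => _.
    rewrite /c; under eq_bigr do rewrite scaler_suml.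
    rewrite exchange_big; apply: eq_bigr => b _.
    by rewrite -[RHS]sumX; apply: eq_bigr => y _; rewrite eq_sym.
  under eq_bigr do rewrite scalerBl.
  rewrite sumrB; congr (_ - _); case: ifP => _; rewrite ?sumX //;
  by rewrite big1 // => y _; rewrite scale0r.
rewrite [RHS](partition_big (fun b => inord (mu b) : 'I_n) predT) //=.
apply: eq_bigr => k _; rewrite /c mulr_sumr; apply: eq_bigr => b /eqP <-.
by rewrite inordK // /index_monomial !mpolyXD -!mpolyXn mulrC mulrA mulrAC.
Qed.

Definition main_index (b a : 'I_j) : {ffun 'I_n -> 'I_N} :=
  [ffun k => if k == ord0 then w a else if linked mu (b, k) then x1 else x0].

Lemma content_main_index b a : content (main_index b a) = index_monomial b a.
Proof.
apply/mnmP => i; rewrite content_sum mnm_sumE big_ord_recl !mnmDE !mulmnE !mnm1E ffunE eqxx -addnA.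
congr (_ + _)%N; transitivity (\sum_(k < n') (if k < mu b then (x1 == i) : nat else (x0 == i)))%N.
  by apply: eq_bigr => k _; rewrite mnm1E ffunE /= /linked /= /bump /= add1n; case: ifP.
rewrite sum_threshold; last by have := mun b.
by rewrite [(mu b * _)%N]mulnC [((n' - _) * _)%N]mulnC.
Qed.

Local Notation z := (\sum_b 'X_[C, index_monomial b b]).

Lemma coef_z m : z@_m = (\sum_b (index_monomial b b == m))%:R.
Proof. by rewrite raddf_sum natr_sum; apply: eq_bigr => b _; rewrite /= mcoeffX. Qed.

Lemma symT_diag b : symT z (main_index b b) != 0.
Proof.
rewrite /symT mulf_neq0 ?invr_eq0 ?card_content_neq0 // coef_z content_main_index pnatr_eq0.
by rewrite (bigD1 b) //= eqxx.
Qed.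

Lemma index_monomialE b a i : index_monomial b a i = ((w a == i) + (x1 == i) * mu b + (x0 == i) * (n' - mu b))%N.
Proof. by rewrite !mnmDE !mulmnE !mnm1E. Qed.

(** No monomial of [z] equals that of [main_index b a]. If [a] is at least 2, the variable x_a
    forces the term of index [a], and then the exponents of x_1 contradict injectivity of [mu]. If
    [a] is 1, then [b] is 0 and the monomial is x_1 x_0^(n-1), which is excluded by [mu b1 != 0]. *)
Lemma symT_upper (b a : 'I_j) : (b < a)%N -> symT z (main_index b a) = 0.
Proof.
move=> ba; rewrite /symT coef_z content_main_index big1 ?mul0r // => c _.
apply/eqP; rewrite eqb0; apply/eqP => /mnmP h.
have w_eq (d e : 'I_j) : (w d == w e) = (d == e) by [].
have e1 := h x1; have ea := h (w a); have ec := h (w c).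
rewrite !index_monomialE !w_eq ?eqxx in e1 ea ec.
have mu1 : mu b1 != 0%N.
  by apply/eqP => h1; have := @mu_inj b1 b0; rewrite mu0 => /(_ h1) /(congr1 val).
have b01 : (b0 == b1) = false by [].
rewrite b01 !mul0n !addn0 !mul1n in e1.
have [a1|a1] := eqVneq a b1.
  have bb : b = b0 by apply/val_inj; move: ba; rewrite a1 /=; case: (val b) => [|[]].
  move: e1 ec; rewrite a1 bb mu0 eqxx /=.
  have [->|c1] := eqVneq c b1; first by move: mu1; case: (mu b1).
  have [->|c0] := eqVneq c b0; first by rewrite mu0.
  by [].
have a0 : a != b0 by apply: contraTneq ba => ->.
move: ea; rewrite ![_ == a]eq_sym (negbTE a1) (negbTE a0) !mul0n !addn0.
rewrite eq_sym; case: eqP => // ca _; move: e1; rewrite ca => /addnI /mu_inj ab.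
by rewrite ab ltnn in ba.
Qed.

Lemma ref_index1 : main_index b0 b1 = [ffun k => if k == ord0 then x1 else x0].
Proof. by apply/ffunP => k; rewrite !ffunE /linked mu0 leqn0 lt0n; case: (k == ord0) => //; case: (k == 0 :> nat). Qed.

Lemma ref_index0 : main_index b0 b0 = [ffun k => x0].
Proof. by apply/ffunP => k; rewrite !ffunE /linked mu0 leqn0 lt0n; case: (k == ord0) => //; case: (k == 0 :> nat). Qed.

(** Only [chi0] contributes: any other [chi] has coefficient 0 or puts the monomial x_1 x_0^(n-1),
    absent from [z], on a reference block. The remaining sum over [s] is the determinant of a
    triangular matrix with nonzero diagonal. *)
Lemma dot_bracket_tensor_neq0 :
  dot [ffun t : {ffun 'I_j + 'I_j * 'I_n -> {ffun 'I_n -> 'I_N}} => \prod_b symT z (t b) : C^o]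
    (bracket_tensor C n' j2 jN mu) != 0.
Proof.
rewrite dot_bracket_tensor.
pose chi0 : {ffun 'I_j * 'I_n -> bool} := [ffun p => linked mu p].
pose c0 : C := \prod_p (if linked mu p then (if chi0 p then -1 else 1) else (if chi0 p then 0 else 1)).
have c0nz : c0 != 0.
  by apply/prodf_neq0 => p _; rewrite ffunE; case: (linked mu p); rewrite ?oppr_eq0 oner_neq0.
pose k0 := \prod_(p : 'I_j * 'I_n) symT z (main_index b0 b0).
have k0nz : k0 != 0 by apply/prodf_neq0 => p _; apply: symT_diag.
rewrite (eq_bigr (fun s : 'S_j => (-1) ^+ s * \prod_b symT z (main_index b (s b)) * (Num.conj c0 * k0))).
  rewrite -mulr_suml mulf_neq0 ?mulf_neq0 ?conjC_eq0 //.
  rewrite (eq_bigr (fun s : 'S_j => (-1) ^+ s *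
    \prod_b (\matrix_(b, a) symT z (main_index b a)) b (s b))) => [|s _]; last first.
    by congr (_ * _); apply: eq_bigr => b _; rewrite mxE.
  rewrite -/(determinant _) det_trig.
    by apply/prodf_neq0 => b _; rewrite mxE symT_diag.
  by apply/is_trig_mxP => b a ba; rewrite mxE symT_upper.
move=> s _; rewrite (bigD1 chi0) //= [X in _ + X]big1 ?addr0; last first.
  move=> chi ne.
  have [p hp] : exists p, chi p != linked mu p.
    apply/existsP; apply: contraR ne; rewrite negb_exists => /forallP h.
    by apply/eqP/ffunP => p; rewrite ffunE; have := h p; rewrite negbK => /eqP.
  case lp : (linked mu p) hp => hp.
    have e : bracket_index j2 jN mu s chi (inr p) = main_index b0 b1.
      rewrite ref_index1; apply/ffunP => k; rewrite !ffunE lp.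
      by move: hp; case: (chi p); rewrite ?andbT.
    by rewrite ffunE (bigD1 (inr p)) //= e symT_upper // mul0r mulr0.
  rewrite /bracket_coef (bigD1 p) //= lp; move: hp; case: (chi p) => // _.
  by rewrite mul0r mulr0 conjC0 mul0r.
rewrite /bracket_coef -/c0 rmorphM rmorph_sign /= -!mulrA; congr (_ * _).
rewrite ffunE big_sumType /= mulrCA; congr (_ * (_ * _)).
  apply: eq_bigr => b _; congr (symT _ _); apply/ffunP => k; rewrite !ffunE.
  by rewrite andbb.
apply: eq_bigr => p _; congr (symT _ _); rewrite ref_index0; apply/ffunP => k; rewrite !ffunE.
by rewrite andbN andbF.
Qed.

Lemma sum_linked : (\sum_(p : 'I_j * 'I_n) linked mu p = \sum_b mu b)%N.
Proof.
rewrite -(pair_bigA _ (fun b k => linked mu (b, k) : nat)); apply: eq_bigr => b _ /=.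
rewrite big_ord_recl /= add0n.
transitivity (\sum_(k < n') (if k < mu b then 1 else 0))%N.
  by apply: eq_bigr => k _; rewrite /linked /= /bump add1n; case: ifP.
by rewrite sum_threshold ?muln1 ?muln0 ?addn0 // -ltnS.
Qed.

(** Coordinate 0 is excluded; it is controlled later through the size of the weight. *)
Lemma bracket_weightE (i : 'I_N) : (0 < i)%N ->
  bracket_weight n' mu i = ((i < j) + (i < 2) * \sum_b mu b)%N.
Proof.
move=> i0; rewrite /bracket_weight -sum_linked big_distrr /=; congr (_ + _)%N.
have -> : (i < 1)%N = false by rewrite ltnS leqn0 gtn_eqF.
apply: eq_bigr => p _; rewrite [X in (_ + X)%N]big1 ?addn0 //.
by case: (linked mu p); rewrite ?muln1 ?muln0 ?if_same.
Qed.

Lemma bracket_highest_weight : highest_weights (Det R n) (\row_i (bracket_weight n' mu i)%:Z).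
Proof.
apply: (det_weights_criterion (v := bracket_tensor C n' j2 jN mu) (m := hess_form)).
- move=> i k ik; have le h : ((k < h) <= (i < h))%N.
    by case: (ltnP k h) => // kh; rewrite (leq_ltn_trans ik kh).
  rewrite leq_add // leq_sum // => p _; apply: leq_add; last by apply: leq_sum.
  case: ifP => // _; rewrite leq_add //; by case: ifP.
- by move=> g hg _; apply: bracket_tensor_weight.
by rewrite det_hess_form; apply: dot_bracket_tensor_neq0.
Qed.

End BracketWeight.

(** * Saturation *)

Lemma sum_initial N h : (h <= N)%N -> (\sum_(i < N) (i < h)%N = h)%N.
Proof.
move=> hN; transitivity (\sum_(i < N) (if i < h then 1 else 0))%N.
  by apply: eq_bigr => i _; case: ifP.
by rewrite sum_threshold // muln1 muln0 addn0.
Qed.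

Lemma sum_bt_weight n' N j (jN : (j <= N)%N) (mu : 'I_j -> nat) : (1 < N)%N ->
  (n'.+1 %| \sum_(i < N) bracket_weight n' mu i)%N.
Proof.
move=> N1; have N0 := ltnW N1.
rewrite /bracket_weight big_split /= sum_initial // exchange_big /=.
(* Every slot carries one unit of weight: a pair [p] accounts for the [n] slots of its reference
   block and, if [p.2 != ord0], for slot [p.2] of its main block. *)
rewrite (eq_bigr (fun p : 'I_j * 'I_n'.+1 => n'.+1 + (p.2 != ord0))%N) => [|p _].
  rewrite big_split /= sum_nat_const addnCA dvdn_addr; last by rewrite dvdn_mull.
  rewrite -(pair_bigA _ (fun _ k => (k != ord0) : nat)) /= sum_nat_const card_ord.
  rewrite big_ord_recl /= add0n (eq_bigr (fun=> 1%N)) // sum1_card card_ord.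
  by rewrite -mulnS dvdn_mull.
rewrite big_split /= [X in (_ + X)%N]exchange_big /= [X in (_ + X)%N](eq_bigr (fun=> 1%N)) => [|k _]; last by rewrite sum_initial.
rewrite sum1_card cardC1 card_ord /= addnC addSn -addnS; congr (_ + _)%N.
case lp : (linked mu p).
  rewrite sum_initial //; move: lp; rewrite /linked -val_eqE /= lt0n.
  by case/andP => ->.
rewrite big_split /= sum_initial // addn1; congr _.+1.
by case: eqP => _; [rewrite big1 | rewrite sum_initial].
Qed.

Section PowerWeight.
Variables (R : realType) (n' : nat).
Local Notation n := n'.+1.
Local Notation N := (n * n)%N.
Local Notation C := R[i].

(** The highest weight vector is the [n]-th tensor power of the first basis vector, tested on the
    form x_0^n. *)
Lemma power_highest_weight : highest_weights (Det R n) (\row_i (n * (i < 1))%N%:Z).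
Proof.
have N0 : (0 < N)%N by [].
pose x0 : 'I_N := Ordinal N0.
pose t0 : {ffun unit -> {ffun 'I_n -> 'I_N}} := [ffun=> [ffun=> x0]].
pose v : {ffun {ffun unit -> {ffun 'I_n -> 'I_N}} -> C^o} := [ffun t => (t == t0)%:R].
apply: (det_weights_criterion (v := v) (m := fun i k x => (i == k)%:R * (x == x0)%:R)).
- by move=> i k ik; rewrite leq_mul2l /=; case: (ltnP k 1) => // k1; rewrite (leq_ltn_trans ik k1).
- move=> g hg _; apply/ffunP => t; rewrite !ffunE (bigD1 t0) //= !ffunE eqxx mulr1.
  rewrite big1 ?addr0 => [|t' /negbTE ht]; last by rewrite ffunE ht mulr0.
  have scE (a b : C) : a *: (b : C^o) = a * b by [].
  rewrite scE -(tensor_kernel1 C t t0) (bigD1 x0) //= [X in _ * X * _]big1 => [|i i0]; last first.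
    by rewrite ltnS leqn0 -[(i == 0 :> nat)]/(i == x0) (negbTE i0) muln0 expr0.
  rewrite mulr1 muln1 /tensor_kernel /kernel_power !(big_pred1 tt); [|by case|by case].
  rewrite -[X in _ ^+ X]card_ord -prodr_const -big_split /=; apply: eq_bigr => k _.
  rewrite !ffunE mxE; have [->|kx] := eqVneq (t tt k) x0; first by rewrite mulr1.
  by rewrite hg ?mulr0 // lt0n; move: kx; rewrite -val_eqE.
rewrite /dot (bigD1 t0) //= big1 ?addr0 => [|t /negbTE ht]; last by rewrite [v _]ffunE ht conjC0 mulr0.
rewrite !ffunE eqxx conjC1 mulr1 (big_pred1 tt) => [|[]] //.
rewrite (_ : \det _ = \prod_(i < n) \sum_(x < N) (x == x0)%:R *: 'X_x); last first.
  rewrite det_trig; last first.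
    apply/is_trig_mxP => i k ik; rewrite mxE big1 // => x _.
    by rewrite -val_eqE ltn_eqF // mul0r scale0r.
  by apply: eq_bigr => i _; rewrite mxE; apply: eq_bigr => x _; rewrite eqxx mul1r.
rewrite (symT_prod (fun _ x => (x == x0)%:R)) mulf_neq0 ?invr_eq0 ?pnatr_eq0 -?lt0n ?fact_gt0 //.
rewrite [X in X != 0](eq_bigr (fun _ : 'S_n => 1)) => [|p _]; last by rewrite big1 // => i _; rewrite !ffunE eqxx.
by rewrite sumr_const pnatr_eq0 -lt0n; apply/card_gt0P; exists 1%g.
Qed.

End PowerWeight.

Section Saturation.
Variables (R : realType) (n' : nat).
Local Notation n := n'.+1.
Local Notation N := (n * n)%N.
Hypothesis n2 : (2 < n)%N.
Variable T : set 'rV[int]_N.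
Hypotheses (subT : submonoid T) (ST : (highest_weights (Det R n) `<=` T)%classic).
Implicit Types (x y : 'rV[int]_N).

Let nN : (n <= N)%N.
Proof. by rewrite leq_pmulr. Qed.

Let T0 : T 0. Proof. by case: subT. Qed.
Let TD x y : T x -> T y -> T (x + y). Proof. by case: subT => _; apply. Qed.

Lemma submonoid_muln x k : T x -> T (x *+ k).
Proof. by move=> Tx; elim: k => [|k IH]; rewrite ?mulr0n // mulrS; apply: TD. Qed.

Local Notation G := (diff_group T).

Lemma diff_group_sub x : T x -> G x.
Proof. by move=> Tx; exists x, 0; rewrite subr0. Qed.

Lemma diff_group_add x y : G x -> G y -> G (x + y).
Proof.
move=> [a [b [Ta Tb ->]]] [c [d [Tc Td ->]]]; exists (a + c), (b + d).
by split; [exact: TD | exact: TD | rewrite opprD addrACA].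
Qed.

Lemma diff_group_opp x : G x -> G (- x).
Proof. by move=> [a [b [Ta Tb ->]]]; exists b, a; rewrite opprB. Qed.

Lemma diff_group_mulz x (k : int) : G x -> G (x *~ k).
Proof.
move=> [a [b [Ta Tb ->]]]; have h m : G ((a - b) *+ m).
  by exists (a *+ m), (b *+ m); rewrite mulrnBl; split=> //; apply: submonoid_muln.
by case: k => m; rewrite ?NegzE ?mulrNz; [|apply: diff_group_opp]; apply: h.
Qed.

(** Subtracting the last coordinate in the support, times [om], leaves a partition with shorter
    support; [om] itself has a multiple in [T] by [rectangular_weight]. *)
Lemma multiple_in_submonoid m x : (m <= n)%N -> partition_weight x ->
  (forall i : 'I_N, (m <= i)%N -> x 0 i = 0) -> exists2 k, (0 < k)%N & T (x *+ k).
Proof.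
elim: m x => [|m IH] x mn [dx px] hx.
  exists 1%N => //; rewrite mulr1n (_ : x = 0) //.
  by apply/rowP => i; rewrite hx // mxE.
have mN : (m < N)%N by apply: leq_trans nN.
have [k k0 hk] := rectangular_weight R (ltn0Sn m) mn.
pose om : 'rV[int]_N := \row_i (if (i < m.+1)%N then 1 else 0).
have om_k : om *+ k = \row_i (if (i < m.+1)%N then k else 0)%:Z.
  by apply/rowP => i; rewrite mulmxnE !mxE; case: ifP; rewrite ?mul0rn // natz.
pose c := `|(x 0 (Ordinal mN))%R|%N.
have cE : x 0 (Ordinal mN) = c%:Z by rewrite /c gez0_abs.
have omE (i : 'I_N) : (om *+ c) 0 i = if (i < m.+1)%N then x 0 (Ordinal mN) else 0.
  by rewrite mulmxnE mxE; case: ifP; rewrite ?mul0rn // cE natz.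
have xE (i : 'I_N) : (x - om *+ c) 0 i = x 0 i - (if (i < m.+1)%N then x 0 (Ordinal mN) else 0).
  by rewrite -omE !mxE.
have [||K K0 hK] := IH (x - om *+ c) (ltnW mn).
- split=> [i i' ii'|i]; rewrite !xE.
  + have [i'm|mi'] := ltnP i' m.+1.
      by rewrite (leq_ltn_trans ii' i'm) lerD2r dx.
    rewrite (hx i' mi') subr0; case: ifP => im; rewrite ?subr0 ?px // subr_ge0.
    by apply: dx; rewrite -ltnS.
  + case: ifP => im; rewrite ?subr0 ?px // subr_ge0.
    by apply: dx; rewrite -ltnS.
- move=> i mi; rewrite xE.
  have [im|im] := ltnP i m.+1; last by rewrite hx // subr0.
  have -> : i = Ordinal mN by apply/val_inj/eqP; rewrite /= eqn_leq mi andbT -ltnS.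
  by rewrite subrr.
exists (K * k)%N; first by rewrite muln_gt0 K0.
have -> : x *+ (K * k) = (x - om *+ c) *+ K *+ k + om *+ k *+ (c * K).
  by rewrite -!mulrnA mulrnBl -!mulrnA [(k * _)%N]mulnC -mulnA subrK.
by apply: TD; apply: submonoid_muln => //; rewrite om_k; apply: ST.
Qed.

Lemma weight_sizeB x y : weight_size (x - y) = weight_size x - weight_size y.
Proof. by rewrite /weight_size -sumrB; apply: eq_bigr => i _; rewrite !mxE. Qed.

(** For [m] at least 2 the bracket weight with [m + 1] rows and [mu b = b] serves. For [m = 1]
    coordinate 1 is one plus the sum of [mu], so the weights for the exponents (0,2) and (0,1) are
    subtracted; the exponent 2 requires [2 < n]. *)
Lemma unit_coordinate_weight (m : 'I_N) : (0 < m < n)%N -> exists2 y, G y &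
  [/\ y 0 m = 1, forall i : 'I_N, (m < i)%N -> y 0 i = 0 & (n%:Z %| weight_size y)%Z].
Proof.
move=> /andP [m0 mn].
have N1 : (1 < N)%N by apply: leq_trans nN; apply: ltnW.
have size_bt j (mu : 'I_j -> nat) : (j <= N)%N ->
    (n%:Z %| weight_size (\row_(i < N) (bracket_weight n' mu i)%:Z))%Z.
  move=> jN; rewrite /weight_size (eq_bigr (fun i : 'I_N => (bracket_weight n' mu i)%:Z)) => [|i _]; last by rewrite mxE.
  by rewrite -(big_morph Posz PoszD (erefl _)); apply: sum_bt_weight.
have [m1|m1] := ltnP 1 m.
  have jN : (m.+1 <= N)%N by [].
  pose mu (b : 'I_m.+1) : nat := b.
  have mun b : (mu b < n)%N by apply: leq_trans (ltn_ord b) mn.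
  exists (\row_i (bracket_weight n' mu i)%:Z).
    apply/diff_group_sub/ST; apply: (@bracket_highest_weight R n' m.+1 (ltnW m1) jN mu).
    - exact: val_inj.
    - by [].
    - exact: mun.
  split; last exact: size_bt.
    by rewrite mxE (bracket_weightE mun) // ltnSn ltnNge m1 mul0n addn0.
  move=> i mi; rewrite mxE (bracket_weightE mun); last exact: leq_ltn_trans mi.
  by rewrite ltnNge mi ltnNge (leq_trans m1 (ltnW mi)).
have me : m = 1%N :> nat by apply/eqP; rewrite eqn_leq m1 m0.
have jN : (2 <= N)%N by [].
pose mu (c : nat) (b : 'I_2) : nat := (b * c)%N.
have mun c b : (c < n)%N -> (mu c b < n)%N.
  by apply: leq_ltn_trans; rewrite /mu -[X in (_ <= X)%N]mul1n leq_mul2r -ltnS ltn_ord orbT.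
have hw c : (0 < c < n)%N -> T (\row_i (bracket_weight n' (mu c) i)%:Z).
  move=> /andP [c0 cn]; apply/ST; apply: (@bracket_highest_weight R n' 2 isT jN (mu c)).
  - by move=> b b' /eqP; rewrite eqn_pmul2r // => /eqP /val_inj.
  - by [].
  - by move=> b; apply: mun.
exists (\row_i (bracket_weight n' (mu 2%N) i)%:Z - \row_i (bracket_weight n' (mu 1%N) i)%:Z).
  by apply: diff_group_add; [|apply: diff_group_opp]; apply/diff_group_sub/hw; rewrite /= ?n2 ?(ltnW n2).
have val_i (i : 'I_N) : (0 < i)%N -> (\row_i (bracket_weight n' (mu 2%N) i)%:Z - \row_i (bracket_weight n' (mu 1%N) i)%:Z) 0 i
    = (i < 2)%N%:Z.
  move=> i0; rewrite !mxE (bracket_weightE (fun b => mun 2%N b n2)) // (bracket_weightE (fun b => mun 1%N b (ltnW n2))) //.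
  by rewrite !big_ord_recl !big_ord0 /mu /=; case: (i < 2)%N.
split.
- by rewrite val_i // me.
- by move=> i mi; rewrite val_i ?(leq_ltn_trans _ mi) // ltnNge -me mi.
- rewrite weight_sizeB.
  by rewrite rpredB // size_bt.
Qed.

(** Coordinates are cleared from the last one downwards with [unit_coordinate_weight]. The size
    stays divisible by [n], so what remains is a multiple of the weight in
    [power_highest_weight]. *)
Lemma diff_group_contains m x : (0 < m <= n)%N -> (forall i : 'I_N, (m <= i)%N -> x 0 i = 0) ->
  (n%:Z %| weight_size x)%Z -> G x.
Proof.
elim: m x => // -[_|m IH] x mn hx nx.
  have N0 : (0 < N)%N by [].
  pose o : 'I_N := Ordinal N0.
  have xo : weight_size x = x 0 o.
    rewrite /weight_size (bigD1 o) //= big1 ?addr0 // => i io; apply: hx.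
    by rewrite lt0n; move: io; rewrite -val_eqE.
  move: nx; rewrite xo => /dvdzP [q hq].
  have -> : x = (\row_i (n * (i < 1))%N%:Z) *~ q.
    apply/rowP => i; rewrite -scaler_int !mxE intz.
    have [->|io] := eqVneq i o; first by rewrite hq /= muln1.
    have i0 : (0 < i)%N by rewrite lt0n; move: io; rewrite -val_eqE.
    by rewrite hx // ltnNge i0 muln0 mulr0.
  by apply/diff_group_mulz/diff_group_sub/ST/power_highest_weight.
have mN : (m.+1 < N)%N by apply: leq_trans nN; case/andP: mn.
have [|y Gy [y1 y0 ny]] := unit_coordinate_weight (m := Ordinal mN).
  by case/andP: mn.
rewrite -(subrK (y *~ x 0 (Ordinal mN)) x); apply: diff_group_add; last exact: diff_group_mulz.
have xE (i : 'I_N) : (x - y *~ x 0 (Ordinal mN)) 0 i = x 0 i - x 0 (Ordinal mN) * y 0 i.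
  by rewrite -scaler_int !mxE intz.
apply: IH; first by case/andP: mn => _ /ltnW.
  move=> i mi; rewrite xE.
  have [im|im] := leqP i m.+1; last by rewrite hx // y0 // mulr0 subr0.
  have -> : i = Ordinal mN by apply/val_inj/eqP; rewrite /= eqn_leq im mi.
  by rewrite y1 mulr1 subrr.
rewrite /weight_size; under eq_bigr do rewrite xE.
by rewrite sumrB -mulr_sumr rpredB // dvdz_mull.
Qed.

End Saturation.

Lemma Sat_Det_contains_partitions (R : realType) (n : nat) (hn : (2 < n)%N)
    (lambda : 'rV[int]_(n * n))
    (lambda_part : partition_weight lambda)
    (lambda_length : (weight_length lambda <= n)%N)
    (lambda_size : (weight_size lambda = 0 %[mod n%:Z])%Z) :
  Sat (highest_weights (Det R n)) lambda.
Proof.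
case: n hn lambda lambda_part lambda_length lambda_size => // n' hn lambda hp hl hs T [[subT satT] ST].
have nN : (n'.+1 <= n'.+1 * n'.+1)%N by rewrite leq_pmulr.
have supp (i : 'I_(n'.+1 * n'.+1)) : (n'.+1 <= i)%N -> lambda 0 i = 0.
  move=> ni; apply/eqP; apply: contraT => li; have [dl pl] := hp.
  (* If entry [i] were nonzero, dominance would make all entries up to [i] nonzero, which is more
     than [n] of them. *)
  move: hl; rewrite leqNgt /weight_length => /negP; case.
  have iN : (i.+1 <= n'.+1 * n'.+1)%N by [].
  apply: (@leq_trans #|'I_i.+1|); first by rewrite card_ord.
  have inj : injective (widen_ord iN) by move=> a b /(congr1 val) ab; apply: val_inj.
  rewrite -(card_imset _ inj) subset_leq_card //.
  apply/fintype.subsetP => _ /imsetP [k _ ->]; rewrite inE.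
  rewrite gt_eqF // (lt_le_trans (y := lambda 0 i)) ?lt_def ?li ?pl //.
  by apply: dl; rewrite /= -ltnS.
have [k k0 Tk] := multiple_in_submonoid subT ST (leqnn _) hp supp.
apply: (satT lambda k) => //.
apply: (diff_group_contains hn subT ST (m := n'.+1)) => //; first by rewrite leqnn.
by apply/dvdz_mod0P; rewrite hs mod0z.
Qed.

Theorem theorem1p1 (R : realType) (n : nat) (hn : (2 < n)%N)
    (lambda : 'rV[int]_(n * n))
    (lambda_part : partition_weight lambda)
    (lambda_length : (weight_length lambda <= n)%N)
    (lambda_size : (weight_size lambda = 0 %[mod n%:Z])%Z) :
  Sat (highest_weights (Det R n)) lambda /\
  (~ highest_weights (Det R n) lambda ->
   hole (highest_weights (Det R n)) lambda).
Proof.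
have h := Sat_Det_contains_partitions hn lambda_part lambda_length lambda_size.
by split=> // nS; split.
Qed.
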